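(* Let $n>6$ be an integer. Let $h$ be the unique integer with $5\cdot2^{h-1}+1<n\le5\cdot2^h+1$, and let $m$ be the nearest integer to $(n+1)/5$, so that $n\in\{5m-3,5m-2,5m-1,5m,5m+1\}$ (one has $m>2^{h-1}$). Construct a plane rooted tree $T_n$ as follows: start from the complete binary tree of height $h-1$ (every non-leaf has exactly two children and all $2^{h-1}$ leaves are at level $h-1$); replace each of the $m-2^{h-1}$ leftmost leaves by a copy of $[[\bullet,\bullet,\bullet],[\bullet,\bullet,\bullet]]$ (i.e., give it two children and give each of these three children); replace each of the remaining $2^h-m$ leaves by a copy of $[\bullet,\bullet,\bullet]$ (give it three children). The result has $5m-1$ vertices. Then: if $n=5m-1$ stop; if $n=5m-2$, remove the last leaf in the canonical order; if $n=5m-3$, remove one leaf child from each of the last two vertices in the canonical order that have leaf children; if $n=5m$, add one leaf child to the first vertex in the canonical order that has leaf children; if $n=5m+1$, add one leaf child to each of the first two vertices in the canonical order that have leaf children. Then $T_n$ is a minimal tree of order $n$. If $n\not\equiv2\pmod5$, then $T_n$ is (up to isomorphism of rooted trees) the only minimal tree of order $n$. If $n\equiv2\pmod5$, then $T_n$ contains exactly one branch isomorphic to $[[\bullet,\bullet],[\bullet,\bullet]]$, and the minimal trees of order $n$ are exactly $T_n$ and the tree obtained from $T_n$ by replacing this branch by $[[\bullet,\bullet,\bullet],\bullet,\bullet]$.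
   Context: A rooted tree $T$ is a finite tree with a distinguished vertex, its root; its order $|T|$ is its number of vertices; the $i$-th level consists of the vertices at distance $i$ from the root. For vertices $u,v$, the infimum of $u$ and $v$ is the vertex common to the path from $u$ to the root and the path from $v$ to the root that is furthest from the root. A set $X\subseteq V(T)$ is infima closed if the infimum of any two elements of $X$ lies in $X$. $I(T)$ denotes the number of nonempty infima closed subsets of $V(T)$. For $n\ge1$, $m_n=\min\{I(T): |T|=n\}$; a rooted tree $T$ with $I(T)=m_{|T|}$ is called minimal. A branch of $T$ is the subtree consisting of a vertex and all its descendants. $[B_1,\dots,B_k]$ denotes the rooted tree whose root has exactly $k$ children with branches $B_1,\dots,B_k$, and $\bullet$ denotes the one-vertex tree. For a rooted tree embedded in the plane (children ordered left to right), the canonical order of vertices orders them first by level (lower level first) and, within a level, from left to right. *)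

(* Defs.v *)
From mathcomp Require Import all_boot.
From Stdlib Require List Permutation.
Set Implicit Arguments. Unset Strict Implicit. Unset Printing Implicit Defensive.

Inductive tree : Type := Node of seq tree.

Definition leaf : tree := Node [::].
Definition children (t : tree) : seq tree := let: Node ts := t in ts.

(* Vertices are addressed by paths from the root: the root is [::], and
   i :: p is the vertex at address p in the branch of the i-th child.
   verts t lists them in preorder (uniq). *)
Fixpoint verts (t : tree) : seq (seq nat) :=
  let: Node ts := t in
  [::] :: (fix aux (i : nat) (ts : seq tree) : seq (seq nat) :=
             match ts with
             | [::] => [::]
             | c :: cs => map (cons i) (verts c) ++ aux i.+1 cs
             end) 0 ts.

Definition tree_order (t : tree) : nat := size (verts t).

(* infimum of two vertices = longest common prefix of their addresses *)
Fixpoint lcp (u v : seq nat) : seq nat :=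
  match u, v with
  | a :: u', b :: v' => if a == b then a :: lcp u' v' else [::]
  | _, _ => [::]
  end.

Definition I (t : tree) : nat :=
  let V := verts t in
  #|[set X : {set 'I_(size V)} |
      (X != set0) &&
      [forall i in X, forall j in X, exists k in X,
         nth [::] V k == lcp (nth [::] V i) (nth [::] V j)]]|.

Definition minimal (t : tree) : Prop :=
  forall t' : tree, tree_order t' = tree_order t -> I t <= I t'.

Inductive iso : tree -> tree -> Prop :=
| iso_Node (l1 l2 l3 : seq tree) :
    List.Forall2 iso l1 l2 -> Permutation.Permutation l2 l3 ->
    iso (Node l1) (Node l3).

Fixpoint subtree_at (t : tree) (p : seq nat) {struct p} : tree :=
  match p with
  | [::] => t
  | i :: p' => subtree_at (nth leaf (children t) i) p'
  end.

Fixpoint modify_at (g : tree -> tree) (p : seq nat) (t : tree) {struct p} : tree :=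
  match p with
  | [::] => g t
  | i :: p' => let ts := children t in
               Node (set_nth leaf ts i (modify_at g p' (nth leaf ts i)))
  end.

Definition is_leaf (t : tree) : bool := nilp (children t).
Definition has_leaf_child (t : tree) : bool := has is_leaf (children t).

Definition canon (t : tree) : seq (seq nat) :=
  flatten [seq [seq p <- verts t | size p == k] | k <- iota 0 (tree_order t)].

Definition add_leaf (t : tree) : tree := Node (rcons (children t) leaf).

Fixpoint rem_first_leaf (ts : seq tree) : seq tree :=
  match ts with
  | [::] => [::]
  | c :: cs => if is_leaf c then cs else c :: rem_first_leaf cs
  end.

Definition del_leaf (t : tree) : tree :=
  Node (rev (rem_first_leaf (rev (children t)))).

(* remove the vertex (a leaf) at a nonroot address p *)
Definition del_vertex (p : seq nat) (t : tree) : tree :=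
  modify_at (fun s => let ts := children s in
                      Node (take (last 0 p) ts ++ drop (last 0 p).+1 ts))
            (take (size p).-1 p) t.

Definition star3 : tree := Node [:: leaf; leaf; leaf].
Definition big : tree := Node [:: star3; star3].

Fixpoint full (d : nat) (f : nat -> tree) (off : nat) : tree :=
  match d with
  | 0 => f off
  | d'.+1 => Node [:: full d' f off; full d' f (off + 2 ^ d')]
  end.

Definition base_tree (h m : nat) : tree :=
  full h.-1 (fun j => if j < m - 2 ^ h.-1 then big else star3) 0.

Definition leafy (t : tree) : seq (seq nat) :=
  [seq p <- canon t | has_leaf_child (subtree_at t p)].

Definition last_leaf (t : tree) : seq nat :=
  last [::] [seq p <- canon t | is_leaf (subtree_at t p)].

Definition Tn (n h m : nat) : tree :=
  let t := base_tree h m in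
  let L := leafy t in
  if n.+1 == 5 * m then t
  else if n.+2 == 5 * m then del_vertex (last_leaf t) t
  else if n.+3 == 5 * m then
    (* last two vertices with leaf children: first the very last one
       (it is not an ancestor of the other), then the second to last *)
    modify_at del_leaf (nth [::] L (size L - 2))
      (modify_at del_leaf (last [::] L) t)
  else if n == 5 * m then modify_at add_leaf (nth [::] L 0) t
  else
    modify_at add_leaf (nth [::] L 1) (modify_at add_leaf (nth [::] L 0) t).

Definition Q22 : tree := Node [:: Node [:: leaf; leaf]; Node [:: leaf; leaf]].
Definition R311 : tree := Node [:: star3; leaf; leaf].

Definition distn (a b : nat) : nat := (a - b) + (b - a).

(* Main.v *)
From Stdlib Require Import ZArith Lia.
From Stdlib Require List Permutation.
Require Import Defs.
From mathcomp Require Import all_boot.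
From mathcomp Require Import zify.
Set Implicit Arguments. Unset Strict Implicit. Unset Printing Implicit Defensive.

(** An infima closed set either contains the root, and then restricts to an arbitrary
    (possibly empty) infima closed set of every branch, or lies in a single branch, so
    [I [B_1, ..., B_k] = prod (1 + I B_i) + sum (I B_i)].  Merging two branches,
    not both leaves, lowers this value as soon as [prod (1 + I)] over the other branches
    is at least 4, and the few other roots of degree different from 2 are treated directly.
    For two branches [I + 2] is the product of the branch values [I + 2], minus 1.  It remains
    to find the pair [(a, b)] with [a + b = u] that minimizes [C a * C b], where [C u] is
    the least value of [I + 2] for trees of order [u - 1].  A pair other than the one
    occurring in [T_n] is improved by exchanging subtrees: two cousins, a vertex and a
    nephew, or (recursively) two cousins whose total size is not split as in [T_n].
    The recursion replaces [C x * C y] by a form [K * C x * C y - P * C x - Q * C y],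
    with [P] and [Q] small compared with [K]. *)

(** * Infima closed sets *)

(** To leading order [C] is multiplicative: an exchange of blocks leaves the product of all block
    values unchanged, and only the terms coming from the [- 1] of each join decide. Multiplying out
    two joins with one block of each held fixed is what produces [P * C x] and [Q * C y]; the ratio
    [P / K] is about the inverse of the value of a fixed block, so it stays tiny and the class of
    forms is stable under the recursion. The scale [5 * 2 ^ j] is the size code of a complete binary
    tree of height [j] ending in copies of [star3], which has code 5. The obstacle is the sizes
    [3 * S - 3] and [4 * S - 3], where the two added leaves of T_n fall into different halves. Near
    them all inner pairs can be optimal while the outer pair is not, and a numerical comparison with
    a narrow margin is required. Since [C] is defined through a tree, its monotonicity and growth
    are not known beforehand; they are derived from optimality at smaller sizes within the same
    induction. *)

Lemma tree_ind_In (P : tree -> Prop) :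
  (forall ts, (forall t, List.In t ts -> P t) -> P (Node ts)) -> forall t, P t.
Proof.
move=> H; fix IH 1 => -[ts]; apply: H.
elim: ts => [|t ts IHts] s; first by case.
by case=> [<-|]; [apply: IH|apply: IHts].
Qed.

(** Vertex sets are counted as subsequences of the preorder list, because the subsequences of a
    concatenation factor over its blocks. *)
Fixpoint subs (T : Type) (s : seq T) : seq (seq T) :=
  if s is x :: s' then map (cons x) (subs s') ++ subs s' else [:: [::]].

Lemma mem_subs (T : eqType) (s t : seq T) : (t \in subs s) = subseq t s.
Proof.
elim: s t => [|x s IH] t /=; first by rewrite inE; case: t.
rewrite mem_cat IH; case: t => [|y t] /=; first by rewrite sub0seq orbT.
have [->|hxy] := eqVneq y x.
  rewrite mem_map ?IH; last by move=> ? ? [].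
  by apply: orb_idr; apply: subseq_trans (subseq_cons t x).
by rewrite orb_idl // => /mapP[z _ [/eqP]]; rewrite (negPf hxy).
Qed.

Lemma subs_uniq (T : eqType) (s : seq T) : uniq s -> uniq (subs s).
Proof.
elim: s => [|x s IH] //= /andP[hx /IH hs].
rewrite cat_uniq hs map_inj_uniq ?hs ?andbT; last by move=> ? ? [].
apply/hasPn => t; rewrite mem_subs => ht; apply/negP => /mapP[z _ e].
by move/negP: hx; apply; rewrite (mem_subseq ht) // e mem_head.
Qed.

Lemma subs_cat (T : Type) (s t : seq T) :
  subs (s ++ t) = [seq a ++ b | a <- subs s, b <- subs t].
Proof.
elim: s => [|x s IH] /=; first by rewrite cats0 map_id.
by rewrite allpairs_cat allpairs_mapl IH map_allpairs.
Qed.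

Lemma subs_map (T U : Type) (f : T -> U) s : subs (map f s) = map (map f) (subs s).
Proof. by elim: s => [|x s IH] //=; rewrite IH map_cat -!map_comp. Qed.

Lemma count_subs_nil (T : eqType) (s : seq T) : uniq s -> count (pred1 [::]) (subs s) = 1.
Proof. by move=> hs; rewrite count_uniq_mem ?subs_uniq // mem_subs sub0seq. Qed.

Definition inf_closed (s : seq (seq nat)) : bool :=
  all (fun u => all (fun v => lcp u v \in s) s) s.

Lemma inf_closedP s :
  reflect (forall u v, u \in s -> v \in s -> lcp u v \in s) (inf_closed s).
Proof.
apply: (iffP allP) => H u; first by move=> v /H/allP; apply.
by move=> hu; apply/allP => v; apply: H.
Qed.

(** The inner fixpoint of [verts], named so that inductions can start at any child index. *)
Fixpoint branch_verts (i : nat) (ts : seq tree) : seq (seq nat) :=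
  if ts is c :: cs then map (cons i) (verts c) ++ branch_verts i.+1 cs else [::].

Lemma verts_Node ts : verts (Node ts) = [::] :: branch_verts 0 ts.
Proof.
by rewrite /=; congr cons; elim: ts 0 => [|c cs IH] i //=.
Qed.

Definition head_ge (i : nat) (u : seq nat) : bool := if u is j :: _ then i <= j else false.

Lemma head_geS i u : head_ge i.+1 u -> head_ge i u.
Proof. by case: u => [|j u] //= /ltnW. Qed.

Lemma branch_verts_head i ts : all (head_ge i) (branch_verts i ts).
Proof.
elim: ts i => [|c cs IH] i //=; rewrite all_cat; apply/andP; split.
  by apply/allP => u /mapP[v _ ->] /=.
by apply: sub_all (IH _); apply: head_geS.
Qed.

Lemma verts_uniq t : uniq (verts t).
Proof.
elim/tree_ind_In: t => ts; rewrite verts_Node cons_uniq => IH; apply/andP; split.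
  by apply/negP => /(allP (branch_verts_head 0 ts)).
elim: ts {1}0 IH => [|c cs IHcs] i IH //=.
rewrite cat_uniq map_inj_uniq; last by move=> ? ? [].
rewrite IH /=; last by left.
rewrite IHcs ?andbT; last by move=> t ht; apply: IH; right.
apply/hasPn => u /(allP (branch_verts_head _ _)) hu.
by apply/negP => /mapP[v _ e]; rewrite e /= ltnn in hu.
Qed.

Lemma branch_verts_uniq i ts : uniq (branch_verts i ts).
Proof.
have: uniq (branch_verts 0 ts) by have := verts_uniq (Node ts); rewrite verts_Node => /andP[].
have E j : branch_verts j.+1 ts = map (fun u => if u is a :: v then a.+1 :: v else u) (branch_verts j ts).
  elim: ts j => [|c cs IH] j //=; rewrite map_cat IH -map_comp.
  by congr cat; apply: eq_map.
elim: i => [|i IH] // /IH; rewrite E map_inj_in_uniq // => -[|a u] [|b v] //=.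
by move=> _ _ [-> ->].
Qed.

Lemma lcp_neq i j u v : i != j -> lcp (i :: u) (j :: v) = [::].
Proof. by move=> /negPf /= ->. Qed.

Lemma lcp_nilr u : lcp u [::] = [::].
Proof. by case: u. Qed.

Lemma inf_closed_map i s : inf_closed (map (cons i) s) = inf_closed s.
Proof.
have inj : injective (cons i) by move=> ? ? [].
apply/inf_closedP/inf_closedP => H u v hu hv.
  by have := H (i :: u) (i :: v); rewrite /= eqxx !mem_map //; apply.
case/mapP: hu => u' hu' ->; case/mapP: hv => v' hv' ->.
by rewrite /= eqxx mem_map //; apply: H.
Qed.

Section TwoBlocks.
Variables (i : nat) (a b : seq (seq nat)).
Hypothesis hb : all (head_ge i.+1) b.

Lemma mem_blocks u : (i :: u \in map (cons i) a ++ b) = (u \in a).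
Proof.
rewrite mem_cat mem_map; last by move=> ? ? [].
by apply: orb_idr => /(allP hb) /=; rewrite ltnn.
Qed.

Lemma lcp_blocks u v : v \in b -> lcp (i :: u) v = [::] /\ lcp v (i :: u) = [::].
Proof.
move=> /(allP hb); case: v => [|j v] // hj.
by have hij : i != j; [move: hj => /=; lia | rewrite !lcp_neq // eq_sym].
Qed.

(** Vertices of different blocks have the root as infimum; as the root is present, the blocks impose
    independent conditions. *)
Lemma inf_closed_root_blocks :
  inf_closed ([::] :: map (cons i) a ++ b) = inf_closed a && inf_closed ([::] :: b).
Proof.
apply/inf_closedP/andP => [H|[/inf_closedP Ha /inf_closedP Hb] u v].
  split; apply/inf_closedP => u v hu hv.
    have := H (i :: u) (i :: v); rewrite /= eqxx !inE /= !mem_blocks; exact.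
  move: hu hv; rewrite !inE => /orP[/eqP->|hu] //.
  move=> /orP[/eqP->|hv]; first by rewrite lcp_nilr.
  have := H u v; rewrite !inE !mem_cat hu hv !orbT => /(_ isT isT).
  case/orP => [->//|/orP[|->]]; last by rewrite orbT.
  case/mapP => w _ e; move: (allP hb u hu).
  by case: u v e {hu hv} => [|j u] [|k v] //=; case: ifP => //= _ [->]; rewrite ltnn.
rewrite !inE !mem_cat => /orP[/eqP->|hu] //.
move=> /orP[/eqP->|hv]; first by rewrite lcp_nilr.
case/orP: hu => [/mapP[u' hu' ->]|hu]; case/orP: hv => [/mapP[v' hv' ->]|hv].
- by rewrite /= eqxx mem_map ?Ha ?orbT //; move=> ? ? [].
- by rewrite (lcp_blocks _ hv).1.
- by rewrite (lcp_blocks _ hu).2.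
- have := Hb u v; rewrite !inE hu hv !orbT => /(_ isT isT).
  by case/orP=> ->; rewrite ?orbT.
Qed.

(** One vertex from each block would force the missing root into the set, so one of the blocks is
    empty. *)
Lemma inf_closed_blocks :
  inf_closed (map (cons i) a ++ b) =
  if a == [::] then inf_closed b else (b == [::]) && inf_closed a.
Proof.
case: eqP => [->//|/eqP ha].
have [->|hb0] := eqVneq b [::]; first by rewrite cats0 inf_closed_map.
apply/inf_closedP => H.
have [x xa] : exists x, x \in a by case: (a) ha => [|x l] // _; exists x; rewrite mem_head.
have [y yb] : exists y, y \in b by case: (b) hb0 => [|y l] // _; exists y; rewrite mem_head.
have := H (i :: x) y; rewrite mem_blocks xa mem_cat yb orbT (lcp_blocks _ yb).1 => /(_ isT isT).
rewrite mem_cat => /orP[/mapP[] //|/(allP hb)] //.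
Qed.
End TwoBlocks.

Lemma subs_head i ts b : b \in subs (branch_verts i ts) -> all (head_ge i) b.
Proof.
rewrite mem_subs => /mem_subseq h; apply/allP => u /h.
exact: (allP (branch_verts_head i ts)).
Qed.

Lemma count_subs_cat (T : Type) (p : pred (seq T)) s t :
  count p (subs (s ++ t)) = \sum_(a <- subs s) count (fun b => p (a ++ b)) (subs t).
Proof.
rewrite subs_cat count_flatten -map_comp sumnE big_map.
by apply: eq_bigr => a _; rewrite /= count_map.
Qed.

Lemma sum_nat_of_bool (T : Type) (p : pred T) s : \sum_(a <- s) (p a : nat) = count p s.
Proof. by rewrite -sum1_count [RHS]big_mkcond; apply: eq_bigr => a _; case: ifP. Qed.

(** The empty set is included, so that a choice in each branch is a plain product. *)
Definition closed_count (t : tree) : nat := count inf_closed (subs (verts t)).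

Lemma count_root_branches i ts :
  count (fun s => inf_closed ([::] :: s)) (subs (branch_verts i ts)) =
  \prod_(t <- ts) closed_count t.
Proof.
elim: ts i => [|c cs IH] i; first by rewrite big_nil.
rewrite big_cons [branch_verts _ _]/= count_subs_cat subs_map big_map.
rewrite (eq_bigr (fun a => inf_closed a * \prod_(t <- cs) closed_count t)).
  by rewrite -big_distrl /= sum_nat_of_bool.
move=> a _; rewrite -(IH i.+1).
rewrite (eq_in_count (a2 := fun b => inf_closed a && inf_closed ([::] :: b))).
  by case: (inf_closed a); rewrite ?mul1n // mul0n count_pred0.
by move=> b /subs_head hb; rewrite inf_closed_root_blocks.
Qed.

Lemma closed_count_gt0 t : 0 < closed_count t.
Proof.
by rewrite -has_count; apply/hasP; exists [::]; rewrite ?mem_subs ?sub0seq.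
Qed.

(** Each branch contributes its nonempty closed sets; the successor accounts for the empty set,
    which all branches share. *)
Lemma count_nonroot_branches i ts :
  count inf_closed (subs (branch_verts i ts)) = (\sum_(t <- ts) (closed_count t).-1).+1.
Proof.
elim: ts i => [|c cs IH] i; first by rewrite big_nil.
rewrite big_cons [branch_verts _ _]/= count_subs_cat subs_map big_map.
rewrite (eq_bigr (fun a => inf_closed a + (a == [::]) * \sum_(t <- cs) (closed_count t).-1)).
  rewrite big_split -big_distrl /= sum_nat_of_bool sum_nat_of_bool.
  rewrite count_subs_nil ?verts_uniq // mul1n.
  by rewrite -/(closed_count c); have := closed_count_gt0 c; lia.
move=> a _.
rewrite (eq_in_count (a2 := fun b => if a == [::] then inf_closed b
                                     else (b == [::]) && inf_closed a)); last first.
  by move=> b /subs_head hb; rewrite inf_closed_blocks.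
case: eqP => [->|_]; first by rewrite IH mul1n.
rewrite mul0n addn0; case: (inf_closed a); last first.
  by rewrite (eq_count (a2 := pred0)) ?count_pred0 // => b; rewrite andbF.
rewrite (eq_count (a2 := pred1 [::])) ?count_subs_nil ?branch_verts_uniq //.
by move=> b; rewrite andbT.
Qed.

Lemma closed_count_Node ts :
  closed_count (Node ts) =
    \prod_(t <- ts) closed_count t + (\sum_(t <- ts) (closed_count t).-1).+1.
Proof.
rewrite /closed_count verts_Node [subs _]/= count_cat count_map.
by rewrite -(count_nonroot_branches 0) -(count_root_branches 0).
Qed.

(** The map [f], listing the vertices of an index set in preorder, is a bijection onto the
    subsequences of [verts t]; the additional one is the empty set. *)
Lemma I_closed_count t : (I t).+1 = closed_count t.
Proof.
rewrite /I /closed_count; set V := verts t; have uV : uniq V := verts_uniq t.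
pose f (X : {set 'I_(size V)}) := [seq nth [::] V i | i : 'I__ in X].
have mem_f (X : {set 'I_(size V)}) (i : 'I_(size V)) : (nth [::] V i \in f X) = (i \in X).
  apply/mapP/idP => [[j]|iX]; last by exists i; rewrite ?mem_enum.
  rewrite mem_enum => jX /eqP; rewrite nth_uniq // => /eqP/val_inj -> //.
have closed_f X : inf_closed (f X) =
    [forall i in X, forall j in X, exists k in X,
         nth [::] V k == lcp (nth [::] V i) (nth [::] V j)].
  apply/inf_closedP/forall_inP => [H i iX|H u v].
    apply/forall_inP => j jX; apply/exists_inP.
    have := H (nth [::] V i) (nth [::] V j); rewrite !mem_f => /(_ iX jX) /mapP[k].
    by rewrite mem_enum => kX e; exists k; rewrite // -e.
  case/mapP => i; rewrite mem_enum => /H/forall_inP Hi ->.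
  case/mapP => j; rewrite mem_enum => /Hi/exists_inP[k kX /eqP e] ->.
  by rewrite -e mem_f.
pose g (i : 'I_(size V)) := nth [::] V i.
have eV : map g (enum 'I_(size V)) = V.
  transitivity (mkseq (nth [::] V) (size V)); last exact: mkseq_nth.
  by rewrite /mkseq -val_enum_ord -map_comp.
have perm_f : perm_eq [seq f X | X : {set 'I_(size V)}] (subs V).
  apply: uniq_perm; [|exact: subs_uniq|].
    rewrite map_inj_uniq ?enum_uniq // => X Y e; apply/setP => i.
    by rewrite -!mem_f e.
  move=> s; rewrite mem_subs; apply/mapP/idP => [[X _ ->]|hs].
    suff: subseq (f X) (map g (enum 'I_(size V))) by rewrite eV.
    by apply: map_subseq; rewrite [enum 'I_(size V)]enumT; apply: filter_subseq.
  exists [set i : 'I_(size V) | nth [::] V i \in s]; first by rewrite mem_enum.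
  transitivity (filter (mem s) (map g (enum 'I_(size V)))).
    by rewrite eV; apply/(subseq_uniqP uV).
  rewrite filter_map /f /image_mem; congr map.
  by rewrite {2}/enum_mem -enumT; apply: eq_filter => i; rewrite /= inE.
rewrite -(permP perm_f) count_map.
transitivity #|[set X | inf_closed (f X)]|; last first.
  by rewrite cardsE cardE -size_filter [in LHS]/enum_mem -enumT.
rewrite [RHS](cardsD1 set0) inE closed_f.
have -> : [forall i in (set0 : {set 'I_(size V)}), forall j in (set0 : {set 'I_(size V)}),
    exists k in (set0 : {set 'I_(size V)}),
      nth [::] V k == lcp (nth [::] V i) (nth [::] V j)].
  by apply/forall_inP => i; rewrite inE.
by congr S; apply: eq_card => X; rewrite !inE closed_f.
Qed.

Lemma I_Node ts : I (Node ts) = \prod_(t <- ts) (I t).+1 + \sum_(t <- ts) I t.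
Proof.
apply: succn_inj; rewrite I_closed_count closed_count_Node addnS; congr (_ + _).+1.
  by apply: eq_bigr => t _; rewrite I_closed_count.
by apply: eq_bigr => t _; rewrite -I_closed_count.
Qed.

Lemma tree_order_Node ts : tree_order (Node ts) = (\sum_(t <- ts) tree_order t).+1.
Proof.
rewrite /tree_order verts_Node /=; congr S; elim: ts {1}0 => [|c cs IH] i.
  by rewrite big_nil.
by rewrite big_cons /= size_cat size_map IH.
Qed.

(** * Vertices of the base tree in canonical order *)

Lemma full_ext d f g a b : (forall j, j < 2 ^ d -> f (a + j) = g (b + j)) ->
  full d f a = full d g b.
Proof.
elim: d a b => [|d IH] a b H; first by have := H 0 isT; rewrite !addn0.
have e : 2 ^ d.+1 = 2 ^ d + 2 ^ d by rewrite expnS; lia.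
rewrite /= (IH a b) => [|j hj]; last by apply: H; lia.
rewrite (IH (a + 2 ^ d) (b + 2 ^ d)) // => j hj.
by rewrite -!addnA; apply: H; lia.
Qed.

(** The [d] binary digits of [j], most significant first: the address of the bottom position [j],
    counted from the left. *)
Fixpoint addr (d j : nat) : seq nat :=
  if d is d'.+1 then
    if j < 2 ^ d' then 0 :: addr d' j else 1 :: addr d' (j - 2 ^ d')
  else [::].

Lemma size_addr d j : size (addr d j) = d.
Proof. by elim: d j => [|d IH] j //=; case: ifP => _; rewrite /= IH. Qed.

Lemma modify_full d f a j q g : j < 2 ^ d ->
  modify_at g (addr d j ++ q) (full d f a) =
  full d (fun i => if i == a + j then modify_at g q (f i) else f i) a.
Proof.
elim: d a j => [|d IH] a j hj /=.
  by move: hj; rewrite expn0 ltnS leqn0 => /eqP->; rewrite addn0 eqxx.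
have e : 2 ^ d.+1 = 2 ^ d + 2 ^ d by rewrite expnS; lia.
case: ifP => hj' /=.
  rewrite IH //; congr (Node [:: _; _]); apply: full_ext => i hi.
  by rewrite ifF //; lia.
rewrite IH; last by lia.
congr (Node [:: _; _]); last by apply: full_ext => i hi; congr (if _ then _ else _); lia.
by apply: full_ext => i hi; rewrite ifF //; lia.
Qed.

Definition level (P : pred tree) (t : tree) (k : nat) : seq (seq nat) :=
  [seq p <- verts t | (size p == k) && P (subtree_at t p)].

Lemma filter_canon P t :
  [seq p <- canon t | P (subtree_at t p)] =
  flatten [seq level P t k | k <- iota 0 (tree_order t)].
Proof.
rewrite /canon filter_flatten -map_comp; congr flatten; apply: eq_map => k.
by rewrite /= -filter_predI; apply: eq_filter => p; rewrite /= andbC.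
Qed.

Lemma level_pair0 P t1 t2 : level P (Node [:: t1; t2]) 0 = if P (Node [:: t1; t2]) then [:: [::]] else [::].
Proof.
rewrite /level verts_Node [filter _ _]/= cats0 filter_cat !filter_map /=.
by rewrite !(eq_filter (a2 := pred0)) ?filter_pred0 //; case: (P _).
Qed.

Lemma level_pairS P t1 t2 k :
  level P (Node [:: t1; t2]) k.+1 = map (cons 0) (level P t1 k) ++ map (cons 1) (level P t2 k).
Proof.
rewrite /level verts_Node [filter _ _]/= cats0 filter_cat !filter_map /=.
by congr (map _ _ ++ map _ _); apply: eq_filter => p.
Qed.

Lemma level_full P d f a e :
  level P (full d f a) (d + e) =
  flatten [seq map (cat (addr d j)) (level P (f (a + j)) e) | j <- iota 0 (2 ^ d)].
Proof.
elim: d a => [|d IH] a.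
  by rewrite expn0 /= cats0 addn0 map_id_in.
have e2 : 2 ^ d.+1 = 2 ^ d + 2 ^ d by rewrite expnS; lia.
rewrite addSn [full _ _ _]/= level_pairS !IH e2 iotaD map_cat flatten_cat add0n; congr cat.
  rewrite map_flatten -map_comp; congr flatten; apply/eq_in_map => j.
  rewrite mem_iota add0n /= => hj; rewrite -map_comp hj.
  by apply: eq_map => p.
have -> : iota (2 ^ d) (2 ^ d) = map (addn (2 ^ d)) (iota 0 (2 ^ d)) by rewrite -iotaDl addn0.
rewrite -map_comp map_flatten -map_comp.
congr flatten; apply: eq_map => j /=; rewrite -map_comp ltnNge leq_addr /= addKn addnA.
by apply: eq_map.
Qed.

Lemma level_full_lt P d f a k : k < d -> (forall j, ~~ is_leaf (f j)) ->
  (forall t1 t2, ~~ is_leaf t1 -> ~~ is_leaf t2 -> ~~ P (Node [:: t1; t2])) ->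
  level P (full d f a) k = [::].
Proof.
move=> hk hf hP; have nleaf d' a' : ~~ is_leaf (full d' f a') by case: d' => [|d'] /=.
elim: d a k hk => [|d IH] a [|k] // hk; first by rewrite level_pair0 (negPf (hP _ _ _ _)).
by rewrite level_pairS !IH.
Qed.

Lemma flatten_nils (T U : eqType) (f : T -> seq U) s : {in s, forall x, f x = [::]} ->
  flatten (map f s) = [::].
Proof.
elim: s => [|x s IH] H //=; rewrite H ?mem_head // IH // => y hy.
by rewrite H // inE hy orbT.
Qed.

Section BaseTree.
Variables (d k : nat).
Hypothesis hk : 0 < k <= 2 ^ d.
Let f0 (j : nat) : tree := if j < k then big else star3.
Let t0 : tree := full d f0 0.

(** Ensures that the range of levels enumerated by [canon] goes past [d + 2], the deepest level. *)
Lemma base_order : d + 4 <= tree_order t0.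
Proof.
suff H a : d + 4 <= tree_order (full d f0 a) by apply: H.
elim: (d) a => [|d' IH] a; first by rewrite /= /f0; case: ifP.
rewrite [full _ _ _]/=.
by rewrite tree_order_Node !big_cons big_nil; have := IH a; lia.
Qed.

Lemma base_nleaf j : ~~ is_leaf (f0 j).
Proof. by rewrite /f0; case: ifP. Qed.

(** The centre of a single star lies one level above the two centres in a [big], so the positions
    from [k] on precede the first [k]. *)
Lemma base_leafy :
  leafy t0 = map (addr d) (iota k (2 ^ d - k)) ++
             flatten [seq [:: addr d j ++ [:: 0]; addr d j ++ [:: 1]] | j <- iota 0 k].
Proof.
rewrite /leafy (filter_canon has_leaf_child).
have -> : tree_order t0 = d + (2 + (tree_order t0 - d - 2)) by have := base_order; lia.
rewrite !iotaD !map_cat !flatten_cat flatten_nils; last first.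
  move=> e; rewrite mem_iota /= => he; apply: level_full_lt; first by lia.
    exact: base_nleaf.
  by move=> t1 t2 /negPf h1 /negPf h2; rewrite /has_leaf_child /= h1 h2.
rewrite (flatten_nils (s := iota _ (tree_order t0 - d - 2))) ?cats0; last first.
  move=> e; rewrite mem_iota => he; have -> : e = d + (e - d - 2).+2 by lia.
  rewrite level_full; apply: flatten_nils => j _.
  by rewrite /f0; case: (e - d - 2) => [|e']; case: ifP.
rewrite /= add0n -[in level _ _ d](addn0 d) -addn1 !level_full cats0; congr cat.
  have -> : iota 0 (2 ^ d) = iota 0 k ++ iota k (2 ^ d - k) by rewrite -iotaD; congr iota; lia.
  rewrite map_cat flatten_cat flatten_nils; last first.
    by move=> j; rewrite mem_iota /= add0n /f0 => ->.
  transitivity (flatten [seq [:: addr d j] | j <- iota k (2 ^ d - k)]); last exact: flatten_map1.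
  rewrite cat0s; congr flatten; apply/eq_in_map => j; rewrite mem_iota /= => hj.
  by case/andP: hj => hj _; rewrite add0n /f0 ltnNge hj /= cats0.
have -> : iota 0 (2 ^ d) = iota 0 k ++ iota k (2 ^ d - k) by rewrite -iotaD; congr iota; lia.
rewrite map_cat flatten_cat [X in _ ++ X]flatten_nils ?cats0; last first.
  by move=> j; rewrite mem_iota /= add0n /f0 => hj; rewrite ifF //; lia.
congr flatten; apply/eq_in_map => j; rewrite mem_iota /= add0n /f0 => hj.
by rewrite hj.
Qed.

Lemma base_leafy_shallow i : i < 2 ^ d - k -> nth [::] (leafy t0) i = addr d (k + i).
Proof.
move=> hi; rewrite base_leafy nth_cat size_map size_iota hi.
by rewrite (nth_map 0) ?size_iota // nth_iota.
Qed.

Lemma base_leafy_deep_first :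
  nth [::] (leafy t0) (2 ^ d - k) = addr d 0 ++ [:: 0] /\
  nth [::] (leafy t0) (2 ^ d - k).+1 = addr d 0 ++ [:: 1].
Proof.
rewrite base_leafy !nth_cat size_map size_iota ltnn ltnNge leqnSn subnn subSnn.
by case: (k) hk.
Qed.

Lemma base_leafy_deep_last :
  last [::] (leafy t0) = addr d k.-1 ++ [:: 1] /\
  nth [::] (leafy t0) (size (leafy t0) - 2) = addr d k.-1 ++ [:: 0].
Proof.
have [l ->] : exists l, leafy t0 = l ++ [:: addr d k.-1 ++ [:: 0]; addr d k.-1 ++ [:: 1]].
  rewrite base_leafy; have -> : iota 0 k = iota 0 k.-1 ++ [:: k.-1].
    by rewrite -{1}(prednK (n := k)) ?(andP hk).1 // -addn1 iotaD.
  by rewrite map_cat flatten_cat catA /=; eexists.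
by rewrite last_cat nth_cat size_cat addnK ltnn subnn.
Qed.

Lemma base_last_leaf : last_leaf t0 = addr d k.-1 ++ [:: 1; 2].
Proof.
rewrite /last_leaf (filter_canon is_leaf).
have -> : iota 0 (tree_order t0) = iota 0 (d + 2) ++ [:: d + 2] ++ iota (d + 3) (tree_order t0 - d - 3).
  have -> : tree_order t0 = d + 2 + (1 + (tree_order t0 - d - 3)) by have := base_order; lia.
  by rewrite iotaD add0n; congr (_ ++ _ :: iota _ _); lia.
rewrite !map_cat !flatten_cat.
rewrite (flatten_nils (s := iota _ (tree_order t0 - d - 3))) ?cats0; last first.
  move=> e; rewrite mem_iota => he; have -> : e = d + (e - d - 3).+3 by lia.
  by rewrite level_full; apply: flatten_nils => j _; rewrite /f0; case: ifP.
rewrite last_cat /= cats0 level_full.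
have -> : iota 0 (2 ^ d) = iota 0 k.-1 ++ [:: k.-1] ++ iota k (2 ^ d - k).
  have -> : 2 ^ d = k.-1 + (1 + (2 ^ d - k)) by lia.
  by rewrite !iotaD /=; congr (_ ++ _ :: _); rewrite add0n; congr iota; lia.
rewrite !map_cat !flatten_cat [X in _ ++ (_ ++ X)]flatten_nils ?cats0; last first.
  by move=> j; rewrite mem_iota /= add0n /f0 => hj; rewrite ifF //; lia.
by rewrite last_cat /= add0n /f0 ifT //; lia.
Qed.
End BaseTree.

Local Open Scope Z_scope.

(** * The optimal split of a size *)

#[local] Arguments Z.mul : simpl never.
#[local] Arguments Z.add : simpl never.
#[local] Arguments Z.sub : simpl never.
#[local] Arguments Z.pow : simpl never.
#[local] Arguments Z.of_nat : simpl never.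

(* [cval t] is [I t + 2] (see [cval_I]); with this shift a root with two branches
   multiplies: [cval (Node [:: a; b]) = cval a * cval b - 1]. *)
Fixpoint cval (t : tree) : Z :=
  let: Node ts := t in
  foldr (fun s z => (cval s - 1) * z) 1 ts + foldr (fun s z => cval s - 2 + z) 2 ts.

(* A tree of order [n] has size code [u = n + 1], so that size codes add up under
   [Node [:: _; _]]; [bisect u] gives the size codes of the two branches of [T_n]. *)
Definition bisect (u : nat) : nat * nat :=
  if (u < 10)%N then ((u.+1)./2, u./2)
  else
    let S := (5 * 2 ^ trunc_log 2 (u %/ 10))%N in
    let F := (2 * S)%N in
    if u == (F + S - 3)%N then (F - 4, S.+1)%N
    else if u == (2 * F - 3)%N then (F.+1, F - 4)%N
    else if (u <= F + S)%N then (u - S, S)%N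
    else (F, u - F)%N.

(* [canon_tree u] is [T_(u - 1)], extended to small [u] by a minimal tree.  For [u = 7]
   the minimal tree is not unique, but order 6 never occurs among the branches of [T_n]. *)
Fixpoint canon_rec (fuel u : nat) : tree :=
  if fuel is f.+1 then
    if (u < 7)%N then Node (nseq (u - 2) leaf)
    else if u == 7%N then Node [:: star3; leaf]
    else Node [:: canon_rec f (bisect u).1; canon_rec f (bisect u).2]
  else leaf.

Definition canon_tree u := canon_rec u u.
Definition C u := cval (canon_tree u).


(** The first two cases are those where T_n has two added leaves that separate. At [3 * S - 3] one
    goes to the last position of the left half and the other to the first of the right half; at
    [4 * S - 3] one goes to the last position of the right half and the other to the first star on
    the left. *)
Lemma bisect_level (j u : nat) :
  (5 * 2 ^ j.+1 <= u < 5 * 2 ^ j.+2)%N ->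
  let S := (5 * 2 ^ j)%N in
  bisect u =
    if u == (3 * S - 3)%N then (2 * S - 4, S.+1)%N
    else if u == (4 * S - 3)%N then ((2 * S).+1, 2 * S - 4)%N
    else if (u <= 3 * S)%N then (u - S, S)%N
    else (2 * S, u - 2 * S)%N.
Proof.
move=> /andP[]; rewrite !expnS => h1 h2 /=.
have p0 : (0 < 2 ^ j)%N by rewrite expn_gt0.
rewrite /bisect ifF; last by lia.
have -> : trunc_log 2 (u %/ 10) = j.
  apply: trunc_log_eq => //; rewrite expnS leq_divRL // ltn_divLR //; lia.
have -> : (2 * (5 * 2 ^ j) + 5 * 2 ^ j - 3 = 3 * (5 * 2 ^ j) - 3)%N by lia.
have -> : (2 * (2 * (5 * 2 ^ j)) - 3 = 4 * (5 * 2 ^ j) - 3)%N by lia.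
by have -> : (2 * (5 * 2 ^ j) + 5 * 2 ^ j = 3 * (5 * 2 ^ j))%N by lia.
Qed.

Lemma level_exists (u : nat) : (10 <= u)%N ->
  exists j, (5 * 2 ^ j.+1 <= u < 5 * 2 ^ j.+2)%N.
Proof.
move=> h; exists (trunc_log 2 (u %/ 10)).
have h0 : (0 < u %/ 10)%N by lia.
have := trunc_log_bounds (ltnSn 1) h0; cbv zeta.
by rewrite !expnS; set p := (2 ^ _)%N; lia.
Qed.

Lemma bisect_spec (u : nat) : (8 <= u)%N ->
  [/\ ((bisect u).1 + (bisect u).2 = u)%N, ((bisect u).2 <= (bisect u).1)%N & (4 <= (bisect u).2)%N].
Proof.
move=> h; have [h10|h10] := ltnP u 10; first by rewrite /bisect h10 /=; split; lia.
have [j hj] := level_exists h10; rewrite (bisect_level hj).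
move: hj; rewrite !expnS; have p0 : (0 < 2 ^ j)%N by rewrite expn_gt0.
by move: p0; set p := (2 ^ j)%N => p0 hj; repeat case: ifPn => ? /=; split; lia.
Qed.

Lemma canon_recE f u : (u <= f)%N -> canon_rec f u = canon_tree u.
Proof.
rewrite /canon_tree; elim/ltn_ind: u f => u IH [|f] huf.
  by have -> : u = 0%N by lia.
case: u IH huf => [|u] IH huf //.
rewrite /=; case: ifP => // h7; case: ifP => // h8.
have h : (8 <= u.+1)%N by move/eqP: h8; lia.
have [e le1 le2] := bisect_spec h.
rewrite !(IH (bisect u.+1).1) ?(IH (bisect u.+1).2) //; lia.
Qed.

Lemma canon_tree_bisect u : (8 <= u)%N ->
  canon_tree u = Node [:: canon_tree (bisect u).1; canon_tree (bisect u).2].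
Proof.
move=> h; have [e le1 le2] := bisect_spec h.
rewrite {1}/canon_tree; case: u h e le1 le2 => [|u] h e le1 le2 //.
rewrite [LHS]/= ifF; last by lia.
by rewrite ifF; [rewrite !canon_recE //; lia | lia].
Qed.

Lemma C_bisect u : (8 <= u)%N -> C u = C (bisect u).1 * C (bisect u).2 - 1.
Proof. by move=> h; rewrite /C (canon_tree_bisect h) /=; lia. Qed.

Lemma C_bisect_eq u a b : (8 <= u)%N -> bisect u = (a, b) -> C u = C a * C b - 1.
Proof. by move=> h e; rewrite C_bisect // e. Qed.

Lemma pow2_succ j : exists s, [/\ (2 ^ j = s.+1)%N, (2 ^ j.+1 = 2 * s.+1)%N & (2 ^ j.+2 = 4 * s.+1)%N].
Proof.
exists (2 ^ j).-1; have p0 : (0 < 2 ^ j)%N by rewrite expn_gt0.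
by rewrite !expnS; split; lia.
Qed.

Lemma C_ge3 u : 3 <= C u.
Proof.
elim/ltn_ind: u => u IH; have [h|h] := ltnP u 8.
  by do 8 (case: u h IH => [|u] h IH; first by vm_compute).
have [e le1 le2] := bisect_spec h.
have h1 := IH (bisect u).1; have h2 := IH (bisect u).2.
rewrite (C_bisect h); have {h1} : 3 <= C (bisect u).1 by apply: h1; lia.
have {h2} : 3 <= C (bisect u).2 by apply: h2; lia.
by nia.
Qed.

Arguments C_ge3 : clear implicits.

(** * Optimality of smaller sizes and the growth of [C] *)

Definition bisect_optimal (u : nat) : Prop :=
  forall a b : nat, (2 <= a)%N -> (2 <= b)%N -> (a + b)%N = u ->
  C u <= C a * C b - 1 /\
  ((b <= a)%N -> (8 <= u)%N -> C u = C a * C b - 1 -> bisect u = (a, b)).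

Definition optimal_below (u : nat) : Prop :=
  forall v : nat, (4 <= v < u)%N -> bisect_optimal v.

(** Checked by computation. The middle alternative serves sizes below 8, where [canon_tree] is not
    built from [bisect]. *)
Lemma small_optimal a b : (a <= 20)%N -> (2 <= b <= a)%N ->
  C (a + b) < C a * C b - 1 \/ (a + b < 8)%N && (C (a + b) <=? C a * C b - 1)
   \/ bisect (a + b) = (a, b).
Proof.
have H : all (fun a => all (fun b =>
  [|| C (a + b) <? C a * C b - 1,  (a + b < 8)%N && (C (a + b) <=? C a * C b - 1)
    | bisect (a + b) == (a, b)])
  (iota 2 a.-1)) (iota 0 21) by vm_compute.
move=> ha hb.
have ia : a \in iota 0 21 by rewrite mem_iota; lia.
have ib : b \in iota 2 a.-1 by rewrite mem_iota; lia.
move/allP/(_ a ia)/allP/(_ b ib)/or3P: H => [h|h|/eqP h].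
- by left; apply/Z.ltb_lt.
- by right; left.
- by right; right.
Qed.

(** Taking one vertex from the larger part of the split of [v.+1] gives an admissible split of
    [v]. *)
Lemma C_ltS u v : optimal_below u -> (2 <= v < u)%N -> C v < C v.+1.
Proof.
elim/ltn_ind: v => v IH H hv; have [h|h] := ltnP v 7.
  by do 7 (case: v h hv IH => [|v] h hv IH; first by vm_compute).
have h8 : (8 <= v.+1)%N by [].
have [e le1 le2] := bisect_spec h8.
rewrite (C_bisect h8); move: e le1 le2; case: (bisect v.+1) => a b /= e le1 le2.
have [hv' _] := H v ltac:(lia) a.-1 b ltac:(lia) ltac:(lia) ltac:(lia).
have := IH a.-1 ltac:(lia) H ltac:(lia); rewrite prednK; last by lia.
by have := C_ge3 b; nia.
Qed.

Lemma C_lt u x y : optimal_below u -> (2 <= x < y)%N -> (y <= u)%N -> C x < C y.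
Proof.
move=> H; elim: y => [|y IH]; first by lia.
move=> h2 h3.
have h4 : C y < C y.+1 by apply: (C_ltS H); lia.
have [e|e] := eqVneq x y; first by rewrite e.
have h5 : C x < C y by apply: IH; lia.
by lia.
Qed.

Lemma C_le u x y : optimal_below u -> (2 <= x <= y)%N -> (y <= u)%N -> C x <= C y.
Proof.
move=> H h1 h2; have [->|e] := eqVneq x y; first by lia.
by have := @C_lt u x y H ltac:(lia) h2; lia.
Qed.

(** The constant 8/5 is the ratio attained at [v = 3]. It is inherited through the splits, since
    subtracting 8 on the left and 5 on the right only helps. *)
Lemma C_ratio_low u v : optimal_below u -> (2 <= v < u)%N -> 8 * C v <= 5 * C v.+1.
Proof.
elim/ltn_ind: v => v IH H hv; have [h|h] := ltnP v 7.
  by do 7 (case: v h hv IH => [|v] h hv IH; first by vm_compute).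
have h8 : (8 <= v.+1)%N by [].
have [e le1 le2] := bisect_spec h8.
rewrite (C_bisect h8); move: e le1 le2; case: (bisect v.+1) => a b /= e le1 le2.
have [hv' _] := H v ltac:(lia) a.-1 b ltac:(lia) ltac:(lia) ltac:(lia).
have := IH a.-1 ltac:(lia) H ltac:(lia); rewrite prednK; last by lia.
move=> hr; have h3 := C_ge3 b.
have : (8 * C a.-1) * C b <= (5 * C a) * C b by apply: Zmult_le_compat_r; lia.
by lia.
Qed.

(** Equality holds at [v = 6]. The [- 2] pays for the [- 1] of the joins in the inductive step. *)
Lemma C_ratio_up u v : optimal_below u.+1 -> (3 <= v < u)%N -> 4 * C v.+1 <= 7 * C v - 2.
Proof.
elim/ltn_ind: v => v IH H hv; have [h|h] := ltnP v 8.
  by do 8 (case: v h hv IH => [|v] h hv IH; first by vm_compute).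
have [e le1 le2] := bisect_spec h.
rewrite (C_bisect h); move: e le1 le2; case: (bisect v) => a b /= e le1 le2.
have [hv' _] := H v.+1 ltac:(lia) a.+1 b ltac:(lia) ltac:(lia) ltac:(lia).
have hr := IH a ltac:(lia) H ltac:(lia); have h3 := C_ge3 b.
have : (4 * C a.+1) * C b <= (7 * C a - 2) * C b by apply: Zmult_le_compat_r; lia.
by lia.
Qed.

(** * Improving a pair by exchanging blocks *)

Definition improvable (K P Q : Z) (x y : nat) : Prop :=
  exists x' y' : nat, [/\ (2 <= x')%N, (2 <= y')%N, (x' + y' = x + y)%N &
    K * C x' * C y' - P * C x' - Q * C y' < K * C x * C y - P * C x - Q * C y].

(** For [K = 1] the point [(P, Q)] ranges over the triangle with vertices [(0, 0)], [(d/c, 0)] and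
    [(d/c, d/c)]. The form is linear, so positivity at the vertices suffices; the identity [E]
    writes it in barycentric coordinates. *)
Lemma triangle_pos (c d D0 dx dy K P Q : Z) :
  0 < c -> 0 < d -> 0 < D0 -> d * dx < c * D0 -> d * (dx + dy) < c * D0 ->
  0 < K -> 0 <= Q <= P -> c * P <= d * K -> P * dx + Q * dy < K * D0.
Proof.
move=> c0 d0 h0 h1 h2 K0 hQ hP.
have E : d * (K * D0 - P * dx - Q * dy) =
  (d * K - c * P) * D0 + (P - Q) * (c * D0 - d * dx) + Q * (c * D0 - d * (dx + dy)) by ring.
have g1 : 0 <= (d * K - c * P) * D0 by nia.
have g2 : 0 <= (P - Q) * (c * D0 - d * dx) by nia.
have g3 : 0 <= Q * (c * D0 - d * (dx + dy)) by nia.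
suff : 0 < d * (K * D0 - P * dx - Q * dy) by nia.
rewrite E; have [hp|hp] := Z_lt_le_dec 0 P; last first.
  have -> : P = 0 by lia.
  have -> : Q = 0 by lia.
  by nia.
have [hq|hq] := Z_lt_le_dec 0 Q; last by (have q0 : Q = 0 by lia); rewrite q0; nia.
by nia.
Qed.

(** With [s = 5 * 2 ^ j], the pairs produced by [bisect] at sizes from [2 * s] to [4 * s]. The upper
    end [(2 * s, 2 * s)] already belongs to the next level, so consecutive ranges overlap there. *)
Definition bisect_form (s a b : nat) : Prop :=
  ((b = s /\ a <= 2 * s /\ a + 3 <> 2 * s) \/ (a = 2 * s /\ b <= 2 * s /\ b + 3 <> 2 * s) \/
   (a + 4 = 2 * s /\ b = s + 1) \/ (a = 2 * s + 1 /\ b + 4 = 2 * s))%N.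

Lemma bisect_mid j a b : let s := (5 * 2 ^ j)%N in
  (s <= b <= a)%N -> (a <= 2 * s)%N -> bisect (a + b) = (a, b) ->
  (b = s \/ a = 2 * s \/ (a + 4 = 2 * s /\ b = s + 1))%N.
Proof.
move=> s hb ha.
have [hs|hs] := eqVneq (a + b)%N (4 * s)%N; first by lia.
have [p [e0 e1 e2]] := pow2_succ j.
rewrite (@bisect_level j); last by rewrite e1 e2 /s e0 in hs hb ha *; lia.
cbv zeta; rewrite -/s; have s5 : (5 <= s)%N by rewrite /s e0; lia.
case: ifP => [_|_]; last case: ifP => [_|_]; last case: ifP => [h|h]; case=> h1 h2.
all: lia.
Qed.

Lemma bisect_formP j a b : let s := (5 * 2 ^ j)%N in
  (s <= b <= a)%N -> bisect_form s a b -> bisect (a + b) = (a, b).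
Proof.
move=> s hb H.
have s5 : (5 <= s)%N by rewrite /s; have [p [-> _ _]] := pow2_succ j; lia.
have [hs|hs] := eqVneq (a + b)%N (4 * s)%N.
  have [p [e0 e1 e2]] := pow2_succ j.+1.
  have es : (5 * 2 ^ j.+1 = 2 * s)%N by rewrite /s expnS; lia.
  rewrite (@bisect_level j.+1); last by rewrite e1 e2; lia.
  rewrite es; do 2 (rewrite ifF; last by lia).
  rewrite ifT; last by lia.
  by rewrite /bisect_form in H; congr pair; lia.
have [p [e0 e1 e2]] := pow2_succ j.
rewrite (@bisect_level j); last by rewrite e1 e2 /s e0 /bisect_form in hs hb H *; lia.
cbv zeta; rewrite -/s.
rewrite /bisect_form in H; case: ifP => ?; last case: ifP => ?; last case: ifP => ?;
  by congr pair; lia.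
Qed.

Lemma bisect_forms j z : let s := (5 * 2 ^ j)%N in
  (2 * s <= z <= 4 * s)%N ->
  exists a b, [/\ bisect z = (a, b), z = (a + b)%N, (s <= b <= a)%N & bisect_form s a b].
Proof.
move=> s hz.
have s5 : (5 <= s)%N by rewrite /s; have [p [-> _ _]] := pow2_succ j; lia.
suff [a [b [e hb H]]] : exists a b, [/\ z = (a + b)%N, (s <= b <= a)%N & bisect_form s a b].
  by exists a, b; split=> //; rewrite e; apply: (@bisect_formP j).
have [h1|h1] := eqVneq z (3 * s - 3)%N.
  by exists (2 * s - 4)%N, s.+1; split; [lia|lia|rewrite /bisect_form; lia].
have [h2|h2] := eqVneq z (4 * s - 3)%N.
  by exists (2 * s).+1%N, (2 * s - 4)%N; split; [lia|lia|rewrite /bisect_form; lia].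
have [h3|h3] := leqP z (3 * s)%N.
  by exists (z - s)%N, s; split; [lia|lia|rewrite /bisect_form; lia].
by exists (2 * s)%N, (z - 2 * s)%N; split; [lia|lia|rewrite /bisect_form; lia].
Qed.

(** By optimality each new part costs at most the join of its two blocks, and the form increases in
    both values because [K] dominates [P] and [Q]. *)
Lemma improvable_parts u K P Q x y z1 z2 w1 w2 :
  optimal_below u -> (x + y <= u)%N ->
  [&& 2 <= z1, 2 <= z2, 2 <= w1 & 2 <= w2]%N -> (z1 + z2 + (w1 + w2) = x + y)%N ->
  0 <= Q <= P -> P <= K ->
  K * (C z1 * C z2 - 1) * (C w1 * C w2 - 1) - P * (C z1 * C z2 - 1) - Q * (C w1 * C w2 - 1)
    < K * C x * C y - P * C x - Q * C y ->
  improvable K P Q x y.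
Proof.
move=> H hu /and4P[h1 h2 h3 h4] e hQ hP hlt.
have [hz _] := H (z1 + z2)%N ltac:(lia) z1 z2 h1 h2 erefl.
have [hw _] := H (w1 + w2)%N ltac:(lia) w1 w2 h3 h4 erefl.
exists (z1 + z2)%N, (w1 + w2)%N; split; [lia|lia|lia|].
have g1 := C_ge3 (z1 + z2); have g2 := C_ge3 (w1 + w2).
apply: Z.le_lt_trans hlt.
move: (C (z1 + z2)) (C (w1 + w2)) g1 g2 hz hw => X Y g1 g2.
move: (C z1 * C z2 - 1) (C w1 * C w2 - 1) => Z W hz hw.
have m1 : 0 <= (Z - X) * (K * Y - P) by apply: Z.mul_nonneg_nonneg; nia.
have m2 : 0 <= (W - Y) * (K * Z - Q) by apply: Z.mul_nonneg_nonneg; nia.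
by lia.
Qed.

(** The product of all four values cancels; the rest factors as [(C y1 - C x2) * ((K + P) * C x1 -
    (K + Q) * C y2)], with both factors positive. *)
Lemma improvable_swap u K P Q x1 x2 y1 y2 :
  optimal_below u -> (x1 + x2 + (y1 + y2) <= u)%N ->
  (2 <= x2 <= x1)%N -> (2 <= y2 <= y1)%N -> (y1 + y2 <= x1 + x2)%N -> (x2 < y1)%N ->
  C (x1 + x2) = C x1 * C x2 - 1 -> C (y1 + y2) = C y1 * C y2 - 1 ->
  0 < K -> 0 <= Q <= P -> P <= K ->
  improvable K P Q (x1 + x2) (y1 + y2).
Proof.
move=> H hu hx hy hxy hlt ex ey K0 hQ hP.
apply: (improvable_parts (z1 := x1) (z2 := y1) (w1 := x2) (w2 := y2) H hu) => //; try lia.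
rewrite ex ey.
have l1 : C x2 < C y1 by apply: (C_lt H); lia.
have l2 : C y2 < C x1 by apply: (C_lt H); lia.
have := C_ge3 y2; move: (C x1) (C x2) (C y1) (C y2) l1 l2 => a b c d l1 l2 d3.
have p1 : 0 < (K + P) * (a - d) by apply: Z.mul_pos_pos; lia.
have p2 : 0 <= (P - Q) * d by apply: Z.mul_nonneg_nonneg; lia.
have : 0 < (c - b) * ((K + P) * a - (K + Q) * d) by apply: Z.mul_pos_pos; lia.
by lia.
Qed.

(** With [x1] and [y2] fixed, expanding the two joins gives, up to a constant, the form in [x2] and
    [y1] of the last hypothesis. *)
Lemma improvable_middle u K P Q x1 x2 y1 y2 :
  optimal_below u -> (x1 + x2 + (y1 + y2) <= u)%N ->
  (2 <= x1)%N -> (2 <= y2)%N ->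
  C (x1 + x2) = C x1 * C x2 - 1 -> C (y1 + y2) = C y1 * C y2 - 1 ->
  0 < K -> 0 <= Q <= P -> P <= K ->
  improvable (K * C x1 * C y2) ((K + P) * C x1) ((K + Q) * C y2) x2 y1 ->
  improvable K P Q (x1 + x2) (y1 + y2).
Proof.
move=> H hu h1 h2 ex ey K0 hQ hP [x' [y' [hx' hy' e hlt]]].
apply: (improvable_parts (z1 := x1) (z2 := x') (w1 := y') (w2 := y2) H hu) => //; lia.
Qed.

(* The three bounds are the values, at the vertices of the cone of admissible [(K, P, Q)],
   of a form that is linear in [(K, P, Q)]. *)
Lemma improvable_vertices (c d : Z) K P Q x y x' y' :
  (2 <= x')%N -> (2 <= y')%N -> (x' + y' = x + y)%N ->
  0 < c -> 0 < d -> 0 < K -> 0 <= Q <= P -> c * P <= d * K ->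
  [&& 0 <? C x * C y - C x' * C y',
      d * (C x - C x') <? c * (C x * C y - C x' * C y')
    & d * (C x - C x' + (C y - C y')) <? c * (C x * C y - C x' * C y')] ->
  improvable K P Q x y.
Proof.
move=> hx hy e c0 d0 K0 hQ hP /and3P[/Z.ltb_lt h0 /Z.ltb_lt h1 /Z.ltb_lt h2].
exists x', y'; split=> //.
by have := triangle_pos c0 d0 h0 h1 h2 K0 hQ hP; lia.
Qed.

Lemma level_improvable_small j x y K P Q :
  (j <= 1)%N -> let s := (5 * 2 ^ j)%N in
  (s <= y <= x)%N -> (x <= 2 * s)%N -> bisect (x + y) <> (x, y) ->
  0 < K -> 0 <= Q <= P -> 12 * C s * P <= 13 * K ->
  improvable K P Q x y.
Proof.
move=> hj s hy hx hb K0 hQ hP.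
have Hv : all (fun j => let s := (5 * 2 ^ j)%N in all (fun x => all (fun y =>
  let x' := (bisect (x + y)).1 in let y' := (bisect (x + y)).2 in
  (bisect (x + y) == (x, y)) ||
  [&& 0 <? C x * C y - C x' * C y',
      13 * (C x - C x') <? 12 * C s * (C x * C y - C x' * C y')
    & 13 * (C x - C x' + (C y - C y')) <? 12 * C s * (C x * C y - C x' * C y')])
  (iota s (x - s).+1)) (iota s s.+1)) [:: 0; 1]%N by vm_compute.
have ij : j \in [:: 0; 1]%N by rewrite !inE; lia.
have ix : x \in iota s s.+1 by rewrite mem_iota; lia.
have iy : y \in iota s (x - s).+1 by rewrite mem_iota; lia.
have s5 : (5 <= s)%N by rewrite /s; have [p [-> _ _]] := pow2_succ j; lia.
move/allP/(_ j ij)/allP/(_ x ix)/allP/(_ y iy)/orP: Hv => [/eqP//|].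
have [e le1 le2] := @bisect_spec (x + y) ltac:(lia).
apply: improvable_vertices hP => //; try lia.
by have := C_ge3 s; lia.
Qed.

Lemma bisect_double j : let s := (5 * 2 ^ j)%N in
  [/\ bisect (4 * s) = (2 * s, 2 * s)%N, bisect (4 * s).+1 = ((2 * s).+1, 2 * s)%N,
      bisect (4 * s - 2) = (2 * s, 2 * s - 2)%N & bisect (4 * s - 4) = (2 * s, 2 * s - 4)%N].
Proof.
move=> s; have s5 : (5 <= s)%N by rewrite /s; have [p [-> _ _]] := pow2_succ j; lia.
have es : (5 * 2 ^ j.+1 = 2 * s)%N by rewrite /s expnS; lia.
split.
- have -> : (4 * s = 2 * s + 2 * s)%N by lia.
  by apply: (@bisect_formP j); rewrite -/s; [lia|rewrite /bisect_form; lia].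
- have -> : ((4 * s).+1 = (2 * s).+1 + 2 * s)%N by lia.
  by apply: (@bisect_formP j.+1); rewrite es; [lia|rewrite /bisect_form; lia].
- have -> : (4 * s - 2 = 2 * s + (2 * s - 2))%N by lia.
  by apply: (@bisect_formP j); rewrite -/s; [lia|rewrite /bisect_form; lia].
- have -> : (4 * s - 4 = 2 * s + (2 * s - 4))%N by lia.
  by apply: (@bisect_formP j); rewrite -/s; [lia|rewrite /bisect_form; lia].
Qed.

(** The constants come from [j = 0], where [C 10 = 168], [C 11 = 285], [C 8 = 63] and [C 6 = 22].
    The surplus 4, multiplied by [C (2 * s) >= 168] in the inductive step, outweighs the loss of 655
    caused by the [- 1] terms. *)
Lemma spread_ratios j : let s := (5 * 2 ^ j)%N in
  [/\ 168 <= C (2 * s), 285 * C (2 * s) <= 168 * C (2 * s).+1 &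
      349 * C (2 * s - 2) + 4 <= 1000 * C (2 * s - 4)].
Proof.
elim: j => [|j IH]; first by vm_compute.
have -> : (5 * 2 ^ j.+1 = 2 * (5 * 2 ^ j))%N by rewrite expnS; lia.
move: IH; have := bisect_double j; cbv zeta; set s := (5 * 2 ^ j)%N.
have s5 : (5 <= s)%N by rewrite /s; have [p [-> _ _]] := pow2_succ j; lia.
have -> : (2 * (2 * s) = 4 * s)%N by lia.
case=> b1 b2 b3 b4 [h1 h2 h3].
rewrite (C_bisect_eq _ b1) ?(C_bisect_eq _ b2) ?(C_bisect_eq _ b3) ?(C_bisect_eq _ b4); try lia.
by split; nia.
Qed.

(* With [g], [e], [d] standing for blocks carrying one extra vertex, one extra vertex and
   two missing vertices, this says that two missing vertices are cheaper than three
   extra ones. *)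
Lemma spread_improves (K P Q p g f G e d : Z) :
  168 <= p -> 168 <= f -> 285 * p <= 168 * g -> 285 * f <= 168 * G -> g <= 2 * p -> G <= 2 * f ->
  349 * d + 4 <= 1000 * e -> e <= d -> p <= d -> p <= f ->
  0 < K -> 0 <= Q <= P -> 12 * P <= K ->
  K * (f * d - 1) * (p * p - 1) - P * (f * d - 1) - Q * (p * p - 1)
   < K * (G * e - 1) * (g * p - 1) - P * (G * e - 1) - Q * (g * p - 1).
Proof.
move=> p0 f0 hg hG hg2 hG2 he hed hpd hpf K0 hQ hP.
have d0 : 168 <= d by lia.
have e0 : 0 < e by lia.
have gg : 285 * 285 * (p * f) <= 168 * 168 * (g * G).
  have : 285 * p * (285 * f) <= 168 * g * (168 * G) by apply: Z.mul_le_mono_nonneg; lia.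
  by lia.
have gge : 285 * 285 * (p * f) * (349 * d) <= 168 * 168 * (g * G) * (1000 * e).
  by apply: Z.mul_le_mono_nonneg; nia.
have pfd : 0 <= p * f * d by nia.
(* The quotient of [285^2 * 349] by [168^2 * 1000] exceeds 1 by slightly more than 1/229. *)
have gap : p * f * d <= 229 * (g * G * e - p * f * d) by lia.
have fd0 : 0 <= f * d by nia.
(* Here 28224 is 168 squared; its quotient by 229 is just above the 123 of [gap3]. *)
have gap2 : 28224 * (f * d) <= 229 * (p * (g * G * e - p * f * d)).
  have : p * (p * f * d) <= p * (229 * (g * G * e - p * f * d)).
    by apply: Z.mul_le_mono_nonneg_l; lia.
  have : 168 * 168 * (f * d) <= p * p * (f * d) by apply: Z.mul_le_mono_nonneg_r; nia.
  by lia.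
have Ge : G * e <= 2 * f * d by apply: Z.mul_le_mono_nonneg; lia.
have gp : g * p <= 2 * f * d by apply: Z.mul_le_mono_nonneg; lia.
have pp0 : 0 < p * p by nia.
have gap3 : 123 * (f * d) <= p * (g * G * e - p * f * d) by lia.
have pp : p * p <= f * d by apply: Z.mul_le_mono_nonneg; lia.
have := @triangle_pos 12 1 ((G * e - 1) * (g * p - 1) - (f * d - 1) * (p * p - 1))
  (G * e - f * d) (g * p - p * p) K P Q.
have -> : (G * e - 1) * (g * p - 1) - (f * d - 1) * (p * p - 1)
  = p * (g * G * e - p * f * d) - G * e - g * p + f * d + p * p by ring.
by move=> /(_ ltac:(lia) ltac:(lia) ltac:(lia) ltac:(lia) ltac:(lia) K0 hQ ltac:(lia)); lia.
Qed.

(** The exceptions pair size [4 * s - 3], split as [(2 * s + 1, 2 * s - 4)], with size [2 * s] or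
    [2 * s + 1]. No exchange in the middle detects them. *)
Lemma bisect_form_cases s x1 x2 y1 y2 : (10 <= s)%N ->
  (s <= x2 <= x1)%N -> (s <= y2 <= y1)%N -> (y1 <= x2)%N ->
  bisect_form s x1 x2 -> bisect_form s y1 y2 ->
  (y1 = s \/ x2 = 2 * s \/ (x2 + 4 = 2 * s /\ y1 = s + 1))%N ->
  bisect_form (2 * s) (x1 + x2) (y1 + y2) \/
  (y2 = s /\ x1 = 2 * s + 1 /\ x2 + 4 = 2 * s /\ (y1 = s \/ y1 = s + 1))%N.
Proof.
rewrite /bisect_form => s10 hx hy hle [|[|[|]]] fx [|[|[|]]] fy [|[|]] m.
all: first [ exfalso; clear -s10 hx hy hle fx fy m; lia | left; left; lia | left; right; left; lia
  | left; right; right; lia | right; lia ].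
Qed.

(** The middle pair inherits the ratio [(1 + P / K) / C y2], at most [13 / (12 * C s)] once
    [12 * P <= K]. That last bound follows from the hypothesis on [P] because the values at the
    higher level are at least 168, so the hypothesis reproduces itself. *)
Lemma level_improvable u j x y K P Q : optimal_below u ->
  let s := (5 * 2 ^ j)%N in
  (s <= y <= x)%N -> (x <= 2 * s)%N -> (x + y <= u)%N -> bisect (x + y) <> (x, y) ->
  0 < K -> 0 <= Q <= P -> 12 * C s * P <= 13 * K ->
  improvable K P Q x y.
Proof.
move=> H; elim: j x y K P Q => [|j IH] x y K P Q /=.
  by move=> hy hx hu; apply: (@level_improvable_small 0).
case: j IH => [|j] IH hy hx hu hb K0 hQ hP.
  by apply: (@level_improvable_small 1) hP.
set r := (5 * 2 ^ j)%N; pose s := (5 * 2 ^ j.+1)%N.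
have es : (s = 2 * r)%N by rewrite /s /r expnS; lia.
have eS : (5 * 2 ^ j.+2 = 2 * s)%N by rewrite /s expnS; lia.
rewrite eS in hy hx hP.
have s10 : (10 <= s)%N by rewrite /s; have [p [_ -> _]] := pow2_succ j; lia.
have [x1 [x2 [bx ex hx12 fx]]] := @bisect_forms j.+1 x ltac:(lia).
have [y1 [y2 [by_ ey hy12 fy]]] := @bisect_forms j.+1 y ltac:(lia).
rewrite -/s in hx12 fx hy12 fy.
have Cx : C x = C x1 * C x2 - 1 by apply: C_bisect_eq => //; lia.
have Cy : C y = C y1 * C y2 - 1 by apply: C_bisect_eq => //; lia.
have [r1 r2 _] := spread_ratios j; have [r3 r4 r5] := spread_ratios j.+1.
rewrite -/r -/s -es in r1 r2 r3 r4 r5.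
have hPK : 12 * P <= K by nia.
subst x y.
have [hlt|hle] := ltnP x2 y1.
  by apply: (improvable_swap H) => //; lia.
have x2s : (x2 <= 2 * s)%N by rewrite /bisect_form in fx; lia.
have [hm|/eqP hm] := eqVneq (bisect (x2 + y1)) (x2, y1); last first.
  apply: (improvable_middle H) => //; try lia.
  have l1 : C y2 <= C x1 by apply: (C_le H); lia.
  have l2 : C s <= C y2 by apply: (C_le H); lia.
  have g1 := C_ge3 y2; have g2 := C_ge3 x1.
  apply: IH => //; rewrite -/s; try lia.
  - split; first by apply: Z.mul_nonneg_nonneg; lia.
    by apply: Z.mul_le_mono_nonneg; lia.
  - have : C s * (12 * (K + P)) <= C y2 * (13 * K) by apply: Z.mul_le_mono_nonneg; lia.
    have := C_ge3 s => g3 l3.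
    have : C s * (12 * (K + P)) * C x1 <= C y2 * (13 * K) * C x1.
      by apply: Z.mul_le_mono_nonneg_r; lia.
    by lia.
have mid := @bisect_mid j.+1 x2 y1 ltac:(lia) ltac:(lia) hm; rewrite -/s in mid.
have [form|[e2 [h1 [h2 h3]]]] := bisect_form_cases s10 hx12 hy12 hle fx fy mid.
  by case: hb; apply: (@bisect_formP j.+2); rewrite eS.
have H' : optimal_below u.-1.+1 by rewrite prednK //; lia.
have up1 := @C_ratio_up u.-1 s H' ltac:(lia).
have up2 := @C_ratio_up u.-1 (2 * s) H' ltac:(lia).
have l1 : C (2 * s - 4) <= C (2 * s - 2) by apply: (C_le H); lia.
have l2 : C s <= C (2 * s - 2) by apply: (C_le H); lia.
have l3 : C s <= C (2 * s) by apply: (C_le H); lia.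
case: h3 => h3.
(* The pair [(4 * s - 3, 2 * s)] becomes [(4 * s - 4, 2 * s + 1)]: the extra vertex changes
   sides. *)
- have e12 : x2 = (2 * s - 4)%N by lia.
  subst x1 x2 y1 y2.
  apply: (improvable_parts (z1 := 2 * s) (z2 := 2 * s - 4) (w1 := s.+1) (w2 := s) H) => //; try lia.
  have := bisect_double j; rewrite -/r; cbv zeta.
  have -> : (4 * r = 2 * s)%N by lia.
  rewrite -es; case=> b1 b2 _ _.
  have E1 := @C_bisect_eq (2 * s) _ _ ltac:(lia) b1.
  have E2 := @C_bisect_eq (2 * s).+1 _ _ ltac:(lia) b2.
  have low := @C_ratio_low u (2 * s - 4) H ltac:(lia).
  have l4 : C (2 * s - 4).+1 <= C (2 * s) by apply: (C_le H); lia.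
  have l5 : C s < C s.+1 by apply: (C_lt H); lia.
  (* Since [C (2 * s - 4)] is at most 5/8 of [C (2 * s)], the quotient is at most 65/96. *)
  have Pe : P * C (2 * s - 4) < K.
    have : P * (8 * C (2 * s - 4)) <= P * (5 * C (2 * s)) by apply: Z.mul_le_mono_nonneg_l; lia.
    by lia.
  have g3 := C_ge3 s.
  have : 0 < (C s.+1 - C s) * C s * (K + Q - P * C (2 * s - 4)).
    by apply: Z.mul_pos_pos; [apply: Z.mul_pos_pos|]; lia.
  by rewrite Cx Cy addn1 E1 E2; lia.
(* The pair [(4 * s - 3, 2 * s + 1)] becomes [(4 * s - 2, 2 * s)]. *)
- have e12 : x2 = (2 * s - 4)%N by lia.
  subst x1 x2 y1 y2.
  apply: (improvable_parts (z1 := 2 * s) (z2 := 2 * s - 2) (w1 := s) (w2 := s) H) => //; try lia.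
  by rewrite Cx Cy !addn1; apply: spread_improves; lia.
Qed.

(** If the parts lie on different levels, only [a] is taken apart: [(C a1 * C a2 - 1) * C b] is a
    form in [b] and [a1] with [K = C a2], [P = 1] and [Q = 0]. *)
Lemma nonbisect_improvable u a b : optimal_below u ->
  (a + b = u)%N -> (8 <= u)%N -> (2 <= b <= a)%N -> bisect u <> (a, b) ->
  improvable 1 0 0 a b.
Proof.
move=> H eu hu hb hs; subst u.
have [ha|ha] := leqP a 20.
  have [h|[h|h]] := small_optimal ha hb; [|lia|by []].
  have [e le1 le2] := bisect_spec hu; move: h; rewrite (C_bisect hu) => h.
  by exists (bisect (a + b)).1, (bisect (a + b)).2; split; lia.
have [j hj] := @level_exists a.-1 ltac:(lia).
set s := (5 * 2 ^ j)%N.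
have es : (5 * 2 ^ j.+1 = 2 * s)%N by rewrite /s expnS; lia.
have es' : (5 * 2 ^ j.+2 = 4 * s)%N by rewrite /s !expnS; lia.
have s10 : (10 <= s)%N.
  case: j hj @s es es' => [|j] hj s es es'; first by lia.
  by rewrite /s; have [p [_ -> _]] := pow2_succ j; lia.
rewrite es es' in hj.
have [hlt|hge] := leqP (2 * s) b.
  by apply: (@level_improvable (a + b) j.+1) => //; rewrite ?es; lia.
have [a1 [a2 [ba ea ha12 fa]]] := @bisect_forms j a ltac:(lia).
rewrite -/s in ha12 fa.
have Ca : C a = C a1 * C a2 - 1 by apply: C_bisect_eq => //; lia.
have [hlt|hle] := ltnP b a1.
  have [hv _] := H (b + a2)%N ltac:(lia) b a2 ltac:(lia) ltac:(lia) erefl.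
  have l1 : C b < C a1 by apply: (C_lt H); lia.
  exists (b + a2)%N, a1; split; [lia|lia|lia|rewrite Ca].
  have : C (b + a2) * C a1 <= (C b * C a2 - 1) * C a1.
    by apply: Z.mul_le_mono_nonneg_r; have := C_ge3 a1; lia.
  by lia.
have [hm|/eqP hm] := eqVneq (bisect (b + a1)) (b, a1).
  (* Only [a = 2 * s + 1], [b = 2 * s - 4] survives, which is itself a split made by [bisect]. *)
  have mid := @bisect_mid j b a1 ltac:(lia) ltac:(lia) hm; rewrite -/s in mid.
  case: hs; apply: (@bisect_formP j); rewrite -/s; first by lia.
  by rewrite /bisect_form in fa *; lia.
have l1 : C s <= C a2 by apply: (C_le H); lia.
have g3 := C_ge3 a2.
have [x' [y' [hx' hy' e hlt]]] : improvable (C a2) 1 0 b a1.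
  by apply: (@level_improvable (a + b) j) => //; rewrite -/s; lia.
have [hv _] := H (y' + a2)%N ltac:(lia) y' a2 ltac:(lia) ltac:(lia) erefl.
exists (y' + a2)%N, x'; split; [lia|lia|lia|rewrite Ca].
have : C (y' + a2) * C x' <= (C y' * C a2 - 1) * C x'.
  by apply: Z.mul_le_mono_nonneg_r; have := C_ge3 x'; lia.
by lia.
Qed.

(* Since every split other than [bisect u] is improvable, following improvements
   can only end at [bisect u]. *)
Lemma all_bisect_optimal u : (4 <= u)%N -> bisect_optimal u.
Proof.
elim/ltn_ind: u => u IH hu.
have H : optimal_below u by move=> v /andP[h1 h2]; apply: IH.
have [h8|h8] := ltnP u 8.
  have aux a b : (2 <= b <= a)%N -> (a + b)%N = u -> C u <= C a * C b - 1.
    move=> hb e; have [h|[h|h]] := @small_optimal a b ltac:(lia) hb; rewrite e in h.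
    - by lia.
    - by case/andP: h => _ /Z.leb_le.
    - clear -hu h8 h; do 8 (case: u hu h8 h => [|u] hu h8 h; first by move: h => [<- <-]).
      by move: h8.
  move=> a b ha hb e; split; last by lia.
  have [h|h] := leqP b a; first by apply: aux; lia.
  by rewrite Z.mul_comm; apply: aux; lia.
have key : forall n : nat, forall a b, (2 <= b <= a)%N -> (a + b)%N = u ->
    C a * C b <= Z.of_nat n ->
    C u <= C a * C b - 1 /\ (bisect u = (a, b) \/ C u < C a * C b - 1).
  elim=> [|n IHn] a b hb e hn; first by have := C_ge3 a; have := C_ge3 b; nia.
  have [hs|/eqP hs] := eqVneq (bisect u) (a, b).
    by split; [rewrite (C_bisect_eq h8 hs); lia|left].
  have [x [y [hx hy exy hlt]]] := nonbisect_improvable H e h8 hb hs.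
  have [hyx|hyx] := leqP y x.
    by have [] := IHn x y ltac:(lia) ltac:(lia) ltac:(lia); lia.
  by have [] := IHn y x ltac:(lia) ltac:(lia) ltac:(lia); lia.
move=> a b ha hb e.
have hn x : C x = Z.of_nat (Z.to_nat (C x)) by have := C_ge3 x; lia.
have keyab x y : (2 <= y <= x)%N -> (x + y)%N = u ->
    C u <= C x * C y - 1 /\ (bisect u = (x, y) \/ C u < C x * C y - 1).
  move=> hy exy; apply: (key (Z.to_nat (C x * C y))) => //.
  by have := C_ge3 x; have := C_ge3 y; nia.
have [h|h] := leqP b a.
  by have [h1 h2] := keyab a b ltac:(lia) e; split=> // _ _ h3; case: h2 => //; lia.
have [h1 h2] := keyab b a ltac:(lia) ltac:(lia); split; first by lia.
by move=> h3; lia.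
Qed.

(** * Roots with many branches *)

Lemma optimal_below_all u : optimal_below u.
Proof. by move=> v hv; apply: all_bisect_optimal; lia. Qed.

Lemma C_add_le a b : (2 <= a)%N -> (2 <= b)%N -> C (a + b) <= C a * C b - 1.
Proof. by move=> ha hb; have [] := @all_bisect_optimal (a + b) ltac:(lia) a b ha hb erefl. Qed.

Lemma C_add_eq a b : (2 <= b <= a)%N -> (8 <= a + b)%N -> C (a + b) = C a * C b - 1 ->
  bisect (a + b) = (a, b).
Proof.
move=> hb h8; have [_] := @all_bisect_optimal (a + b) ltac:(lia) a b ltac:(lia) ltac:(lia) erefl.
by apply=> //; lia.
Qed.

(** The right side is the value of a root with one branch of value [C u] and two leaves. *)
Lemma C_add3 u : (3 <= u)%N ->
  C (u + 3) <= 5 * C u - 2 /\ ((6 <= u)%N -> C (u + 3) < 5 * C u - 2).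
Proof.
elim/ltn_ind: u => u IH hu; have [h|h] := ltnP u 8.
  by do 8 (case: u h hu IH => [|u] h hu IH; first by vm_compute).
have [e le1 le2] := bisect_spec h.
rewrite (C_bisect h); move: e le1 le2; case: (bisect u) => a b /= e le1 le2.
have [hr _] := IH a ltac:(lia) ltac:(lia); have h3 := C_ge3 b.
have := @C_add_le (a + 3) b ltac:(lia) ltac:(lia).
have -> : (a + 3 + b = u + 3)%N by lia.
have : C (a + 3) * C b <= (5 * C a - 2) * C b by apply: Zmult_le_compat_r; lia.
have : 3 < C b by have := @C_lt b.+1 2 b (@optimal_below_all _) ltac:(lia) ltac:(lia); have := C_ge3 2; lia.
by lia.
Qed.

(* A rooted tree whose branches have orders [u - 1], for [u] in [us], has order
   [forest_size us - 1]. *)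
Definition forest_size (us : seq nat) : nat := foldr (fun u k => u.-1 + k)%N 2%N us.
Definition forest_prod (us : seq nat) : Z := foldr (fun u z => (C u - 1) * z) 1 us.
Definition forest_sum (us : seq nat) : Z := foldr (fun u z => C u - 2 + z) 2 us.
Definition forest_val (us : seq nat) : Z := forest_prod us + forest_sum us.

Lemma perm_foldr (T : eqType) (R : Type) (f : T -> R -> R) z s t :
  (forall a b r, f a (f b r) = f b (f a r)) -> perm_eq s t -> foldr f z s = foldr f z t.
Proof.
move=> fC h; apply: (@catCA_perm_ind _ (fun r => foldr f z s = foldr f z r)) h erefl.
move=> s1 s2 s3 ->; rewrite !foldr_cat; move: (foldr f z s3) => r.
elim: s1 => [|a s1 IH] //=; rewrite IH.
by elim: s2 {IH} => [|b s2 IH] //=; rewrite -IH fC.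
Qed.

Lemma forest_perm us vs : perm_eq us vs ->
  forest_size us = forest_size vs /\ forest_val us = forest_val vs.
Proof.
move=> h; split; last congr (_ + _); rewrite /forest_size /forest_prod /forest_sum.
- by apply: perm_foldr => // *; lia.
- by apply: perm_foldr => // *; lia.
- by apply: perm_foldr => // *; lia.
Qed.

Lemma forest_prod_ge us : 2 ^ Z.of_nat (size us) <= forest_prod us.
Proof.
elim: us => [|u us IH] //=; rewrite Nat2Z.inj_succ Z.pow_succ_r; last by lia.
by apply: Z.mul_le_mono_nonneg => //; have := C_ge3 u; lia.
Qed.

Lemma forest_size_nseq k : forest_size (nseq k 2%N) = k.+2.
Proof. by elim: k => [|k /= ->]. Qed.

Lemma forest_merge a b us : (3 <= a)%N -> (2 <= b)%N -> 4 <= forest_prod us ->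
  forest_val ((a + b).-1 :: us) < forest_val [:: a, b & us].
Proof.
move=> ha hb; rewrite /forest_val /=; move: (forest_prod us) (forest_sum us) => R S hR.
have A5 : 5 <= C a by have := @C_le a 3 a (@optimal_below_all _) ltac:(lia) ltac:(lia).
have [hb2|hb2] := eqVneq b 2%N.
  have -> : (a + b).-1 = a.+1 by lia.
  have := @C_ratio_up a.+1 a (@optimal_below_all _) ltac:(lia).
  rewrite hb2 (_ : C 2 = 3); last by vm_compute.
  move: (C a.+1) (C a) A5 => x A A5 hx.
  (* Four times the drop in value is at least this product, whence the threshold 4 for [R]. *)
  have : 0 < (A - 2) * (R - 3) by nia.
  have : 4 * x * (R + 1) <= (7 * A - 2) * (R + 1) by apply: Z.mul_le_mono_nonneg_r; lia.
  by lia.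
have B5 : 5 <= C b by have := @C_le b 3 b (@optimal_below_all _) ltac:(lia) ltac:(lia).
have := @C_ratio_low a a.-1 (@optimal_below_all _) ltac:(lia).
have := @C_add_le a.-1 b ltac:(lia) hb.
have -> : (a.-1 + b = (a + b).-1)%N by lia.
rewrite prednK; last by lia.
move: (C (a + b).-1) (C a.-1) (C a) (C b) A5 B5 => x A' A B A5 B5 hx hA.
have : 8 * A' * B <= 5 * A * B by apply: Z.mul_le_mono_nonneg_r; lia.
move=> hAB; have {hAB hA} hx8 : 8 * x <= 5 * A * B - 8 by lia.
have : 8 * x * (R + 1) <= (5 * A * B - 8) * (R + 1) by apply: Z.mul_le_mono_nonneg_r; lia.
(* Shifting the variables to their lower bounds turns the claim into an inequality between
   polynomials in nonnegative variables. *)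
have [a1 ea] : exists a1, A = 5 + a1 by exists (A - 5); lia.
have [b1 eb] : exists b1, B = 5 + b1 by exists (B - 5); lia.
have [r er] : exists r, R = 4 + r by exists (R - 4); lia.
have a0 : 0 <= a1 by lia.
have b0 : 0 <= b1 by lia.
have r0 : 0 <= r by lia.
rewrite ea eb er.
have p1 : 0 <= a1 * b1 by nia.
have p2 : 0 <= r * (19 + 7 * a1 + 7 * b1 + 3 * (a1 * b1)) by nia.
by lia.
Qed.

(** The right side is the value of a star with [k] leaves. Its exponential part doubles with each
    leaf, while [C] grows by a factor of at most 7/4. *)
Lemma star_bound k :
  C k.+2 <= 2 ^ Z.of_nat k + Z.of_nat k + 2 /\
  ((5 <= k)%N -> C k.+2 < 2 ^ Z.of_nat k + Z.of_nat k + 2).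
Proof.
elim: k => [|k [IH1 IH2]]; first by vm_compute.
have [h|h] := ltnP k 5.
  by clear IH1 IH2; do 5 (case: k h => [|k] h; first by vm_compute).
have := @C_ratio_up k.+3 k.+2 (@optimal_below_all _) ltac:(lia).
have lin : 3 * Z.of_nat k <= 2 ^ Z.of_nat k.
  elim: k h {IH1 IH2} => [|k IHk] //; rewrite ltnS leq_eqVlt => /orP[/eqP<-|/[dup] h4 /IHk].
    by vm_compute.
  by rewrite Nat2Z.inj_succ Z.pow_succ_r; lia.
have := IH2 h; rewrite Nat2Z.inj_succ Z.pow_succ_r; last by lia.
by lia.
Qed.

(** Necessary conditions for equality in [forest_bound]; the exact shapes are singled out later,
    size by size. *)
Definition tight_forest (us : seq nat) : Prop :=
  [\/ exists2 k, (k <= 4)%N & us = nseq k 2%N,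
      size us = 1%N,
      exists a b, [/\ (2 <= b <= a)%N, (a + b)%N = forest_size us, C (a + b) = C a * C b - 1
                    & perm_eq us [:: a; b]]
    | exists2 a, (3 <= a <= 5)%N & perm_eq us [:: a; 2; 2]%N].

(** With four branches the factors left over by a merge are at least 2 each; with three, the
    remaining factor is at least [C 3 - 1 = 4] unless it belongs to a leaf. So among forests of
    three or more branches, not all leaves, only [[:: a; 2; 2]] resists merging. *)
Lemma forest_bound us : all (leq 2) us ->
  C (forest_size us) <= forest_val us /\
  (forest_val us = C (forest_size us) -> tight_forest us).
Proof.
move: {2}(size us) (erefl (size us)) => k; elim: k us => [|k IH] us hk h2.
  move/size0nil: hk => ->; split; first by vm_compute.
  by move=> _; constructor 1; exists 0%N.
have [hall|] := boolP (all (pred1 2%N) us).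
  move/all_pred1P: hall => hus; rewrite hus.
  have ep j : forest_prod (nseq j 2%N) = 2 ^ Z.of_nat j.
    elim: j => [|j IHj] //; rewrite Nat2Z.inj_succ Z.pow_succ_r; last by lia.
    by rewrite /= IHj.
  have em j : forest_sum (nseq j 2%N) = Z.of_nat j + 2.
    elim: j => [|j IHj] //; rewrite [LHS]/= IHj (_ : C 2 = 3); last by vm_compute.
    by lia.
  rewrite /forest_val forest_size_nseq ep em; have [s1 s2] := star_bound (size us).
  rewrite Z.add_assoc; split=> // e; constructor 1; exists (size us) => //.
  by case: leqP => // /s2; rewrite e => /Z.lt_irrefl.
case/allPn => a aus /= ha2.
have ha : (3 <= a)%N by have /= := allP h2 a aus; lia.
have hp := perm_to_rem aus; move: hp hk h2; move: (rem a us) => l hp hk.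
rewrite (perm_all _ hp) /= => /andP[_ hl].
have [es ev] := forest_perm hp; rewrite es ev.
have hl' : size l = k by move: hk; rewrite (perm_size hp) => -[].
have merge x y r : perm_eq us [:: x, y & r] -> (3 <= x)%N -> (2 <= y)%N -> all (leq 2) r ->
    4 <= forest_prod r -> C (forest_size (a :: l)) < forest_val (a :: l).
  move=> hq hx hy hr R4; have [es' ev'] := forest_perm hq.
  rewrite -es -ev es' ev'.
  have lt := forest_merge hx hy R4.
  have sz : size ((x + y).-1 :: r) = k by move: hk; rewrite (perm_size hq) => -[].
  have [le _] := IH _ sz ltac:(rewrite /= hr andbT; lia).
  have e : forest_size [:: x, y & r] = forest_size ((x + y).-1 :: r) by rewrite /=; lia.
  by rewrite e; apply: Z.le_lt_trans le lt.
have perm_us r : perm_eq (a :: l) r -> perm_eq us r by apply: perm_trans.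
suff [h1 h3] : C (forest_size (a :: l)) <= forest_val (a :: l) /\
    (forest_val (a :: l) = C (forest_size (a :: l)) -> tight_forest us) by [].
case: l hl hl' hp merge perm_us {es ev} => [|b [|c r]] hl hl' hp merge perm_us.
- have -> : forest_size [:: a] = a.+1 by rewrite /=; lia.
  rewrite /forest_val /=; have up := @C_ratio_up a.+1 a (@optimal_below_all _) ltac:(lia).
  by have := C_ge3 a; split; [lia|move=> _; constructor 2; rewrite (perm_size hp)].
- have hb : (2 <= b)%N by case/andP: hl.
  have e : forest_size [:: a; b] = (a + b)%N by rewrite /=; lia.
  rewrite e /forest_val /=; have le := C_add_le (ltnW ha) hb; split; first by lia.
  move=> eq; constructor 3; have [hba|hba] := leqP b a.
    by exists a, b; split=> //; [lia|rewrite -e; have [] := forest_perm hp|lia].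
  exists b, a; split; [lia| |rewrite addnC; lia|].
    by rewrite addnC -e; have [] := forest_perm hp.
  by rewrite (perm_trans hp) // (perm_catC [:: a] [:: b]).
- move: hl; rewrite /= => /and3P[hb hc hr].
  have strict : C (forest_size [:: a, b, c & r]) < forest_val [:: a, b, c & r] ->
      C (forest_size [:: a, b, c & r]) <= forest_val [:: a, b, c & r] /\
      (forest_val [:: a, b, c & r] = C (forest_size [:: a, b, c & r]) -> tight_forest us).
    by move=> lt; split; lia.
  case: r hr hl' hp merge perm_us strict => [|d r] hr hl' hp merge perm_us strict; last first.
    apply/strict/(merge a b (c :: d :: r)) => //; first by rewrite /= hc.
    apply: Z.le_trans (@forest_prod_ge [:: c, d & r]).
    by rewrite /= !Nat2Z.inj_succ !Z.pow_succ_r; have := Z.pow_pos_nonneg 2 (Z.of_nat (size r)); lia.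
  have big x : (3 <= x)%N -> 4 <= forest_prod [:: x].
    move=> hx; have := @C_le x 3 x (@optimal_below_all _) ltac:(lia) ltac:(lia).
    by rewrite (_ : C 3 = 5) //= ; lia.
  have [c2|c2] := eqVneq c 2%N; last first.
    by apply/strict/(merge a b [:: c]) => //; [rewrite /= hc|apply: big; lia].
  have [b2|b2] := eqVneq b 2%N; last first.
    apply/strict/(merge a c [:: b]) => //; [|by rewrite /= hb|by apply: big; lia].
    by apply: perm_us; rewrite perm_cons (perm_catC [:: b] [:: c]).
  subst b c; rewrite /forest_val /=.
  have -> : (a.-1 + (1 + (1 + 2)) = a + 3)%N by lia.
  rewrite (_ : C 2 = 3); last by vm_compute.
  have [le lt] := C_add3 ha; split; first by lia.
  move=> eq; constructor 4; exists a => //.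
  by rewrite ha; case: leqP => // h6; have := lt h6; lia.
Qed.

(** * Minimal trees *)

Lemma cval_I t : cval t = Z.of_nat (I t) + 2.
Proof.
elim/tree_ind_In: t => ts IH.
suff [e1 e2] : foldr (fun s z => (cval s - 1) * z) 1 ts = Z.of_nat (\prod_(t <- ts) (I t).+1) /\
    foldr (fun s z => cval s - 2 + z) 2 ts = Z.of_nat (\sum_(t <- ts) I t) + 2.
  by rewrite /= e1 e2 I_Node; lia.
elim: ts IH => [|t ts IHts] IH; first by rewrite !big_nil.
have [|e1 e2] := IHts; first by move=> s hs; apply: IH; right.
by rewrite !big_cons /= e1 e2 (IH t); [lia|left].
Qed.

Definition size_code (t : tree) : nat := (tree_order t).+1.

Lemma size_code_Node ts : size_code (Node ts) = forest_size (map size_code ts).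
Proof.
rewrite /size_code tree_order_Node; elim: ts => [|t ts IH]; first by rewrite big_nil.
by rewrite big_cons /= -IH; lia.
Qed.

Lemma size_code_ge2 t : (2 <= size_code t)%N.
Proof. by case: t => ts; rewrite /size_code tree_order_Node. Qed.

Lemma all_size_code ts : all (leq 2) (map size_code ts).
Proof. by rewrite all_map; elim: ts => [|t ts IH] //=; rewrite size_code_ge2. Qed.

Lemma size_code2 t : size_code t = 2%N -> t = leaf.
Proof.
case: t => -[|t ts] //; rewrite /size_code tree_order_Node big_cons.
by have := size_code_ge2 t; rewrite /size_code; lia.
Qed.

Definition tight (t : tree) : Prop := cval t = C (size_code t).

(** Product and sum are both monotone in the branch values, and equality of the sums alone makes
    every branch tight. *)
Lemma forest_val_children ts : (forall t, List.In t ts -> C (size_code t) <= cval t) ->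
  forest_val (map size_code ts) <= cval (Node ts) /\
  (forest_val (map size_code ts) = cval (Node ts) -> forall t, List.In t ts -> tight t).
Proof.
move=> H; rewrite /forest_val /forest_prod /forest_sum [cval _]/= !foldr_map.
have pos ts' : 0 <= foldr (fun (t : tree) z => (C (size_code t) - 1) * z) 1 ts'.
  elim: ts' => [|t ts' IH] //=.
  by apply: Z.mul_nonneg_nonneg => //; have := C_ge3 (size_code t); lia.
have hp : foldr (fun t z => (C (size_code t) - 1) * z) 1 ts <=
    foldr (fun s z => (cval s - 1) * z) 1 ts.
  elim: ts H => [|t ts IH] H //=.
  apply: Z.mul_le_mono_nonneg.
  - by have := C_ge3 (size_code t); lia.
  - by have := H t (or_introl erefl); lia.
  - exact: pos.
  - by apply: IH => s hs; apply: H; right.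
have [hs hs'] : foldr (fun t z => C (size_code t) - 2 + z) 2 ts <=
    foldr (fun s z => cval s - 2 + z) 2 ts /\
  (foldr (fun t z => C (size_code t) - 2 + z) 2 ts = foldr (fun s z => cval s - 2 + z) 2 ts ->
    forall t, List.In t ts -> tight t).
  elim: ts H {hp} => [|t ts IH] H /=; first by split.
  have [|i1 i2] := IH; first by move=> s hs; apply: H; right.
  have ht := H t (or_introl erefl).
  split; first by lia.
  move=> e s [<-|hs]; first by rewrite /tight; lia.
  by apply: i2 => //; lia.
by split; [lia|move=> e; apply: hs'; lia].
Qed.

Lemma tree_bound t : C (size_code t) <= cval t.
Proof.
elim/tree_ind_In: t => ts IH; have [h _] := forest_val_children IH.
rewrite size_code_Node; apply: Z.le_trans h.
by have [] := forest_bound (all_size_code ts).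
Qed.

Lemma tight_Node ts : tight (Node ts) ->
  let us := map size_code ts in
  [/\ forest_val us = C (forest_size us), tight_forest us & forall t, List.In t ts -> tight t].
Proof.
move=> e us; rewrite /tight size_code_Node -/us in e.
have [h1 h2] := @forest_val_children ts (fun t _ => @tree_bound t).
have [h3 h4] := forest_bound (all_size_code ts).
have e' : forest_val us = C (forest_size us) by rewrite -/us in h1 h3 e; lia.
by split; [|apply: h4|apply: h2; rewrite e'].
Qed.

Lemma size_code_canon u : (2 <= u)%N -> size_code (canon_tree u) = u.
Proof.
elim/ltn_ind: u => u IH hu; have [h|h] := ltnP u 8.
  by do 8 (case: u h hu IH => [|u] h hu IH; first by vm_compute).
have [e le1 le2] := bisect_spec h.
rewrite (canon_tree_bisect h) size_code_Node [map _ _]/= !IH /=; lia.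
Qed.

(** [canon_tree] attains the lower bound [C] at every order. *)
Lemma minimal_tight t : minimal t <-> tight t.
Proof.
split=> [h|h t' e].
  have e : tree_order (canon_tree (size_code t)) = tree_order t.
    by have := size_code_canon (size_code_ge2 t); rewrite /size_code => -[].
  have := h _ e; have := @tree_bound t.
  have : cval (canon_tree (size_code t)) = C (size_code t) by [].
  by rewrite /tight !cval_I; lia.
have := @tree_bound t'; rewrite {1}/size_code e -/(size_code t) -h !cval_I; lia.
Qed.

(** * Isomorphism and uniqueness of the trees attaining the bound *)

Lemma Forall2_refl_In (T : Type) (R : T -> T -> Prop) l :
  (forall x, List.In x l -> R x x) -> List.Forall2 R l l.
Proof.
elim: l => [|x l IH] H; constructor; first by apply: H; left.
by apply: IH => y hy; apply: H; right.
Qed.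

Lemma iso_refl t : iso t t.
Proof.
elim/tree_ind_In: t => ts IH; apply: (iso_Node (l2 := ts)); last exact: Permutation.Permutation_refl.
exact: Forall2_refl_In.
Qed.

Lemma iso_Permutation ts ss : Permutation.Permutation ts ss -> iso (Node ts) (Node ss).
Proof. by apply: iso_Node; apply: Forall2_refl_In => t _; apply: iso_refl. Qed.

Lemma foldr_Permutation (R : Type) (f : tree -> R -> R) z s t :
  (forall a b r, f a (f b r) = f b (f a r)) -> Permutation.Permutation s t ->
  foldr f z s = foldr f z t.
Proof. by move=> fC; elim=> {s t} [|x s t _ /= ->|x y s|s t r _ -> _ ->] //=. Qed.

Lemma iso_inv t s : iso t s -> size_code t = size_code s /\ cval t = cval s.
Proof.
elim/tree_ind_In: t s => ts IH s h; inversion_clear h as [? l2 l3 h1 h2].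
have [e1 e2] : map size_code ts = map size_code l2 /\ map cval ts = map cval l2.
  elim: h1 IH => {h2 l2 ts} [|t l ts l2 htl _ IHl] IH //=.
  have [-> ->] := IH t (or_introl erefl) l htl.
  by have [|-> ->] := IHl; first by move=> r hr; apply: IH; right.
have hc f (z : Z) : (forall a b r, f a (f b r) = f b (f a r)) ->
    foldr (fun r => f (cval r)) z ts = foldr (fun r => f (cval r)) z l3.
  move=> fC; rewrite -!(foldr_map cval) e2 !foldr_map.
  by apply: foldr_Permutation h2 => *; rewrite fC.
split.
  rewrite !size_code_Node e1 /forest_size !foldr_map.
  by apply: foldr_Permutation h2 => *; lia.
rewrite /= (hc (fun c z => (c - 1) * z)) ?(hc (fun c z => c - 2 + z)) // => *; lia.
Qed.

Lemma iso_pair t1 t2 s1 s2 : iso t1 s1 -> iso t2 s2 ->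
  iso (Node [:: t1; t2]) (Node [:: s1; s2]) /\ iso (Node [:: t2; t1]) (Node [:: s1; s2]).
Proof.
move=> h1 h2; split.
  by apply: (iso_Node (l2 := [:: s1; s2])); [do !constructor|exact: Permutation.Permutation_refl].
by apply: (iso_Node (l2 := [:: s2; s1])); [do !constructor|exact: Permutation.perm_swap].
Qed.

Lemma perm_eq_pair (x y a b : nat) : perm_eq [:: x; y] [:: a; b] ->
  (x = a /\ y = b) \/ (x = b /\ y = a).
Proof.
move=> h; have /= := perm_mem h x; rewrite !inE eqxx /= => /esym/orP[/eqP e|/eqP e].
  by subst x; move: h; rewrite perm_cons => /perm_mem/(_ y); rewrite !inE eqxx => /esym/eqP ->; left.
subst x; right; split=> //; move: h; rewrite (perm_sym [:: b; y]) (perm_catC [:: a] [:: b]).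
by rewrite perm_cons => /perm_mem/(_ y); rewrite !inE eqxx => /eqP.
Qed.

Lemma tight_pair ts a b : tight (Node ts) -> perm_eq (map size_code ts) [:: a; b] ->
  exists t1 t2, [/\ ts = [:: t1; t2] \/ ts = [:: t2; t1], tight t1, tight t2,
                    size_code t1 = a & size_code t2 = b].
Proof.
move=> /tight_Node[_ _ ht] hp.
move: (perm_size hp); case: ts ht hp => [|t1 [|t2 [|t3 ts]]] //= ht hp _.
have h1 : tight t1 by apply: ht; left.
have h2 : tight t2 by apply: ht; right; left.
case: (perm_eq_pair hp) => -[e1 e2]; [exists t1, t2|exists t2, t1]; split=> //; by [left|right].
Qed.

Lemma tight_star (u : nat) t : (u \in [:: 2; 4; 5; 6])%N -> size_code t = u -> tight t ->
  t = canon_tree u.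
Proof.
move=> hu e; case: t e => ts e ht.
have [hv tf _] := tight_Node ht.
move: hv tf; rewrite -size_code_Node e => hv tf.
have h2 : map size_code ts = nseq (u - 2) 2%N.
  case: tf => [[k hk]|hs|[a [b [hb eab eC hp]]]|[a ha hp]].
  - by move=> us; move: e; rewrite size_code_Node us forest_size_nseq => <-; rewrite subn2.
  - move: (all_size_code ts) hs hv e; rewrite size_code_Node.
    case: (map _ _) => [|a [|]] //= /andP[a2 _] _ hv e.
    have ea : a = u.-1 by lia.
    move: hv; rewrite ea /forest_val /=.
    by move: hu; rewrite !inE => /or4P[] /eqP ->; vm_compute.
  - have [es _] := forest_perm hp.
    move: eab; rewrite -size_code_Node e => eab.
    have h4 : (a <= 4)%N by move: hu; rewrite !inE; lia.
    have : [&& a < 5, b < 5, a + b \in [:: 2; 4; 5; 6], 2 <= b, b <= a &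
      (C (a + b) =? C a * C b - 1)%Z]%N.
      by rewrite (introT (Z.eqb_spec _ _) eC) eab hu; lia.
    have : all (fun a => all (fun b => [&& a < 5, b < 5, a + b \in [:: 2; 4; 5; 6], 2 <= b, b <= a &
      (C (a + b) =? C a * C b - 1)%Z]%N ==> (a == 2%N) && (b == 2%N)) (iota 0 5)) (iota 0 5) by vm_compute.
    move/allP/(_ a); rewrite mem_iota => /(_ ltac:(lia))/allP/(_ b).
    rewrite mem_iota => /(_ ltac:(lia)) /implyP h /h /andP[/eqP ea /eqP eb].
    move: hp eab; rewrite ea eb => hp <-.
    have hs := perm_size hp; move: hs hp; case: (map _ _) => [|x [|y [|]]] //= _ hp.
    by case: (perm_eq_pair hp) => -[-> ->].
  - have [es ev] := forest_perm hp; move: e ha hv hu; rewrite size_code_Node es ev /= => <-.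
    move=> ha hv hu; have ea : a = 3%N by move: hu; rewrite !inE; lia.
    by move: hv; rewrite ea; vm_compute.
have -> : ts = nseq (u - 2) leaf.
  elim: ts (u - 2)%N h2 {e ht hv tf} => [|t ts IH] [|k] //= [h1 h2].
  by rewrite (IH _ h2) (@size_code2 t) // /size_code h1.
by move: hu; rewrite !inE => /or4P[] /eqP ->.
Qed.

(** The range starts at 9 because at 8 the forest [[:: 5; 2; 2]] attains the bound as well. *)
Lemma tight_bisect u t : (9 <= u)%N -> size_code t = u -> tight t ->
  exists t1 t2, [/\ t = Node [:: t1; t2] \/ t = Node [:: t2; t1], tight t1, tight t2,
    size_code t1 = (bisect u).1 & size_code t2 = (bisect u).2].
Proof.
move=> hu; case: t => ts e ht; have [hv tf _] := tight_Node ht.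
move: hv tf; rewrite -size_code_Node e => hv tf.
suff hp : perm_eq (map size_code ts) [:: (bisect u).1; (bisect u).2].
  have [t1 [t2 [h h1 h2 h3 h4]]] := tight_pair ht hp.
  by exists t1, t2; split=> //; case: h => ->; [left|right].
case: tf => [[k hk]|hs|[a [b [hb eab eC hp]]]|[a ha hp]].
- move=> us; move: e; rewrite size_code_Node us.
  by rewrite forest_size_nseq; lia.
- move: hs hv e; rewrite size_code_Node; case: (map _ _) => [|a [|]] //= _ hv e.
  have ea : u = a.+1 by lia.
  move: hv; rewrite ea /forest_val /=.
  by have := @C_ratio_up a.+1 a (@optimal_below_all _) ltac:(lia); have := C_ge3 a; lia.
- move: eab eC; rewrite -size_code_Node e => eab eC.
  by have := C_add_eq hb ltac:(lia) eC; rewrite eab => ->.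
- have [es _] := forest_perm hp; move: e; rewrite size_code_Node es /=; lia.
Qed.

Lemma tight8 t : size_code t = 8%N -> tight t -> iso t (canon_tree 8) \/ iso t R311.
Proof.
case: t => ts e ht; have [hv tf ht'] := tight_Node ht.
move: hv tf; rewrite -size_code_Node e => hv tf.
case: tf => [[k hk]|hs|[a [b [hb eab eC hp]]]|[a ha hp]].
- move=> us; move: e; rewrite size_code_Node us forest_size_nseq.
  by case: k hk {us} => [|[|[|[|[|k]]]]].
- move: hs hv e; rewrite size_code_Node; case: (map _ _) => [|a [|]] //= _ hv e.
  have ea : a = 7%N by lia.
  by move: hv; rewrite ea /forest_val /=; vm_compute.
- move: eab eC; rewrite -size_code_Node e => eab eC.
  have := C_add_eq hb ltac:(lia) eC; rewrite eab => -[ea eb].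
  move: hp; rewrite -ea -eb => hp.
  have [t1 [t2 [h h1 h2 h3 h4]]] := tight_pair ht hp.
  left; have -> : Node ts = canon_tree 8; last exact: iso_refl.
  rewrite (@tight_star 4%N t1) // (@tight_star 4%N t2) // in h.
  by case: h => ->.
- have [es _] := forest_perm hp; move: e; rewrite size_code_Node es /= => e.
  have ea : a = 5%N by lia.
  subst a; right.
  have hs := perm_size hp; case: ts ht' hp hs {ht hv es e} => [|x [|y [|z [|]]]] //= ht' hp _.
  have hx : tight x by apply: ht'; left.
  have hy : tight y by apply: ht'; right; left.
  have hz : tight z by apply: ht'; right; right; left.
  have H r : size_code r \in [:: size_code x; size_code y; size_code z] -> tight r ->
      (size_code r = 5%N /\ r = star3) \/ (size_code r = 2%N /\ r = leaf).
    rewrite (perm_mem hp) !inE => /or3P[] /eqP er tr; [left|right|right]; split=> //.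
    - exact: (@tight_star 5%N).
    - exact: (@tight_star 2%N).
    - exact: (@tight_star 2%N).
  have [|//|[ex rx]|[ex rx]] := H x; first by rewrite !inE eqxx.
  all: have [|//|[ey ry]|[ey ry]] := H y; first by rewrite !inE eqxx ?orbT.
  all: have [|//|[ez rz]|[ez rz]] := H z; first by rewrite !inE eqxx ?orbT.
  all: move: hp; rewrite ex ey ez rx ry rz //= => _; apply: iso_Permutation.
  - exact: Permutation.Permutation_refl.
  - exact: Permutation.perm_swap.
  - exact: Permutation.Permutation_sym (Permutation.Permutation_cons_append [:: leaf; leaf] star3).
Qed.

(** From 10 on, one part is a multiple of 5, except in the two special splits, whose parts are both
    1 modulo 5. Residue 3, meaning two missing leaves, is therefore handed to a single part. *)
Lemma bisect_residues u : (9 <= u)%N -> let a := (bisect u).1 in let b := (bisect u).2 in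
  [/\ (4 <= b <= a)%N, (a + b = u)%N, (a <> 7 /\ b <> 7)%N,
      (u %% 5 <> 3 -> a %% 5 <> 3 /\ b %% 5 <> 3)%N &
      (u %% 5 = 3 -> a %% 5 = 3 /\ b %% 5 = 0 /\ 8 <= a \/ a %% 5 = 0 /\ b %% 5 = 3 /\ 8 <= b)%N
      /\ (u %% 5 = 0 -> a %% 5 = 0 /\ b %% 5 = 0)%N].
Proof.
move=> hu a b; have [e le1 le2] := @bisect_spec u ltac:(lia).
rewrite -/a -/b in e le1 le2.
have [h10|h10] := ltnP u 10.
  have e9 : u = 9%N by lia.
  have -> : a = 5%N by rewrite /a e9.
  have -> : b = 4%N by rewrite /b e9.
  by rewrite e9.
have [j hj] := level_exists h10; have := bisect_level hj; cbv zeta.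
move: hj; have [p [e0 e1 e2]] := pow2_succ j; rewrite e0 e1 e2 => hj hb.
have s5 : (a, b) = bisect u by rewrite /a /b; case: (bisect u).
move: hb; rewrite -s5; clear s5; clearbody a b.
case: ifP => h1; last case: ifP => h2; last case: ifP => h3; case=> ea eb; subst a b;
  split; lia.
Qed.

Lemma tight_unique (u : nat) t : (u %% 5 <> 3)%N -> u <> 7%N -> size_code t = u -> tight t ->
  iso t (canon_tree u).
Proof.
elim/ltn_ind: u t => u IH t h3 h7 e ht.
have [h9|h9] := leqP 9 u.
  have [t1 [t2 [et ht1 ht2 e1 e2]]] := tight_bisect h9 e ht.
  have [lab eab [a7 b7] [] // a3 b3 _] := bisect_residues h9.
  rewrite (@canon_tree_bisect u); last by lia.
  have [i1 i2] := iso_pair (IH (bisect u).1 ltac:(lia) t1 a3 a7 e1 ht1)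
    (IH (bisect u).2 ltac:(lia) t2 b3 b7 e2 ht2).
  by case: et => ->.
have u2 := size_code_ge2 t.
rewrite (@tight_star u t) //; first exact: iso_refl.
by rewrite !inE; lia.
Qed.

Lemma mem_verts_pair t1 t2 p : p \in verts (Node [:: t1; t2]) ->
  [\/ p = [::], exists2 q, q \in verts t1 & p = 0%N :: q | exists2 q, q \in verts t2 & p = 1%N :: q].
Proof.
rewrite verts_Node inE /= cats0 mem_cat => /or3P[/eqP->|/mapP[q hq ->]|/mapP[q hq ->]].
- by constructor 1.
- by constructor 2; exists q.
- by constructor 3; exists q.
Qed.

Lemma cval_pair t1 t2 : cval (Node [:: t1; t2]) = cval t1 * cval t2 - 1.
Proof. by rewrite /=; lia. Qed.

Lemma size_code_pair t1 t2 : size_code (Node [:: t1; t2]) = (size_code t1 + size_code t2)%N.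
Proof.
by rewrite /size_code tree_order_Node !big_cons big_nil; lia.
Qed.

(** Codes divisible by 5 split into codes divisible by 5, down to [star3]. *)
Lemma canon_branch_neq8 (u : nat) q : (u %% 5 = 0)%N -> (5 <= u)%N -> q \in verts (canon_tree u) ->
  size_code (subtree_at (canon_tree u) q) <> 8%N.
Proof.
elim/ltn_ind: u q => u IH q h0 h5.
have [h9|h9] := leqP 9 u; last first.
  have -> : u = 5%N by lia.
  have : all (fun q => size_code (subtree_at (canon_tree 5) q) != 8%N) (verts (canon_tree 5)).
    by vm_compute.
  by move=> /allP H /H /eqP.
have [lab eab _ _ [_ [] // ha hb]] := bisect_residues h9.
have eu := size_code_canon (ltac:(lia) : (2 <= u)%N).
rewrite (@canon_tree_bisect u) in eu *; last by lia.
case/mem_verts_pair => [->|[r hr ->]|[r hr ->]]; first by rewrite [subtree_at _ _]/= eu; lia.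
  by apply: (IH (bisect u).1) => //; lia.
by apply: (IH (bisect u).2) => //; lia.
Qed.

(** The address [p] follows residue 3 down to code 8. Every side branch met on the way has code
    divisible by 5, so it is unique and contains no branch of code 8. *)
Lemma defect_branch (u : nat) : (u %% 5 = 3)%N -> (8 <= u)%N ->
  exists p, let V := modify_at (fun _ => R311) p (canon_tree u) in
  [/\ p \in verts (canon_tree u), subtree_at (canon_tree u) p = Q22,
      forall q, q \in verts (canon_tree u) -> size_code (subtree_at (canon_tree u) q) = 8%N -> q = p,
      size_code V = u /\ cval V = C u
    & forall t, size_code t = u -> tight t -> iso t (canon_tree u) \/ iso t V].
Proof.
elim/ltn_ind: u => u IH h3 h8.
have [h9|h9] := leqP 9 u; last first.
  have -> : u = 8%N by lia.
  exists [::]; split=> //; last exact: tight8.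
  have H : all (fun q => (size_code (subtree_at (canon_tree 8) q) == 8%N) ==> (q == [::]))
      (verts (canon_tree 8)) by vm_compute.
  by move=> q /(allP H)/implyP h /eqP/h/eqP.
have [lab eab [a7 b7] _ [H _]] := bisect_residues h9.
have eu := size_code_canon (ltac:(lia) : (2 <= u)%N).
have bound t := tight_bisect h9 (t := t).
rewrite (C_bisect h8); rewrite (@canon_tree_bisect u) in eu *; last by lia.
have ha := size_code_canon (ltac:(lia) : (2 <= (bisect u).1)%N).
have hb := size_code_canon (ltac:(lia) : (2 <= (bisect u).2)%N).
move: H eab lab a7 b7 eu ha hb bound; case: (bisect u) => a b; cbn [fst snd] => H eab lab a7 b7 eu ha hb bound.
have [[a3 [b0 a8]]|[a0 [b3 b8]]] := H h3.
- have [p [hp es hq [eV cV] ht]] := IH a ltac:(lia) a3 a8.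
  exists (0%N :: p); split.
  + by rewrite verts_Node /= inE mem_cat mem_map ?hp // => ? ? [].
  + exact: es.
  + move=> q /mem_verts_pair[->|[r hr ->]|[r hr ->]] /=.
    * by rewrite eu; lia.
    * by move=> e; rewrite (hq r).
    * by move=> e; case: (@canon_branch_neq8 b r); [lia|lia|by []|by []].
  + by rewrite size_code_pair cval_pair eV cV hb; split; [lia|].
  + move=> t e htt; have [t1 [t2 [et ht1 ht2 e1 e2]]] := bound t e htt.
    have i2 := @tight_unique b t2 ltac:(lia) ltac:(lia) e2 ht2.
    have [i1|i1] := ht t1 e1 ht1; have [j1 j2] := iso_pair i1 i2; [left|right]; by case: et => ->.
- have [p [hp es hq [eV cV] ht]] := IH b ltac:(lia) b3 b8.
  exists (1%N :: p); split.
  + by rewrite verts_Node /= inE mem_cat cats0 (@mem_map _ _ (cons 1%N)) ?hp ?orbT // => ? ? [].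
  + exact: es.
  + move=> q /mem_verts_pair[->|[r hr ->]|[r hr ->]] /=.
    * by rewrite eu; lia.
    * by move=> e; case: (@canon_branch_neq8 a r); [lia|lia|by []|by []].
    * by move=> e; rewrite (hq r).
  + by rewrite size_code_pair cval_pair eV cV ha; split; [lia|].
  + move=> t e htt; have [t1 [t2 [et ht1 ht2 e1 e2]]] := bound t e htt.
    have i1 := @tight_unique a t1 ltac:(lia) ltac:(lia) e1 ht1.
    have [i2|i2] := ht t2 e2 ht2; have [j1 j2] := iso_pair i1 i2; [left|right]; by case: et => ->.
Qed.

Local Open Scope nat_scope.

(** * The tree T_n *)

(* Size code of the bottom branch in position [j < H]: the first [k] positions carry two
   triple stars, the others one; [e] leaves are added in canonical order (to the
   one-star positions first, then to the two stars of each of the first [k] positions)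
   and [s] leaves are removed from position [k - 1]. *)
Definition weight (H k e s j : nat) : nat :=
  (if j < k then 10 + (H - k + 2 * j < e) + ((H - k + 2 * j).+1 < e) else 5 + (j < k + e))
  - (if j.+1 == k then s else 0).

Definition filled (d k e s : nat) : tree :=
  full d (fun j => canon_tree (weight (2 ^ d) k e s j)) 0.

Lemma filled_split d k e s k1 e1 s1 k2 e2 s2 :
  let H := 2 ^ d in
  (forall i, i < H -> weight (2 * H) k e s i = weight H k1 e1 s1 i /\
                      weight (2 * H) k e s (H + i) = weight H k2 e2 s2 i) ->
  filled d.+1 k e s = Node [:: filled d k1 e1 s1; filled d k2 e2 s2].
Proof.
move=> H hw; rewrite /filled /=; congr (Node [:: _; _]); apply: full_ext => i hi;
  have [w1 w2] := hw i hi; have e2H : 2 ^ d.+1 = 2 * H by rewrite expnS.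
  by rewrite e2H w1.
by rewrite e2H add0n w2.
Qed.

(** Cutting the row of bottom positions in half distributes [k], [e] and [s] just as [bisect]
    divides the size. The number [2 ^ d + k] bounding [e] counts the vertices with leaf children. *)
Lemma filled_canon d k e s : k <= 2 ^ d -> e <= 2 -> s <= 2 -> (0 < s -> 0 < k /\ e = 0) ->
  e <= 2 ^ d + k -> filled d k e s = canon_tree (5 * (2 ^ d + k) + e - s).
Proof.
elim: d k e s => [|d IH] k e s hk he hs hsk hek.
  rewrite /filled /= /weight expn0; congr canon_tree; rewrite expn0 in hk hek.
  by move: hsk hek; case: k hk => [|[|k]] // _; case: e he => [|[|[|e]]] // _;
    case: s hs => [|[|[|s]]] // _ hsk hek; lia.
set H := 2 ^ d; have eH : 2 ^ d.+1 = 2 * H by rewrite expnS.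
have H0 : 0 < H by rewrite expn_gt0.
have eS : 5 * 2 ^ d.+1 = 10 * H by rewrite eH; lia.
have eS2 : 5 * 2 ^ d.+2 = 20 * H by rewrite expnS eH; lia.
have eS3 : 5 * 2 ^ d.+3 = 40 * H by rewrite !expnS -/H; lia.
rewrite eH in hk hek *.
have step k1 e1 s1 k2 e2 s2 :
    bisect (5 * (2 * H + k) + e - s) = (5 * (H + k1) + e1 - s1, 5 * (H + k2) + e2 - s2) ->
    [&& k1 <= H, e1 <= 2, s1 <= 2, (0 < s1) ==> (0 < k1) && (e1 == 0) & e1 <= H + k1] ->
    [&& k2 <= H, e2 <= 2, s2 <= 2, (0 < s2) ==> (0 < k2) && (e2 == 0) & e2 <= H + k2] ->
    (forall i, i < H -> weight (2 * H) k e s i = weight H k1 e1 s1 i /\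
                        weight (2 * H) k e s (H + i) = weight H k2 e2 s2 i) ->
    filled d.+1 k e s = canon_tree (5 * (2 * H + k) + e - s).
  move=> hb h1 h2 hw; rewrite (filled_split hw) canon_tree_bisect; last by lia.
  by rewrite hb !IH //; lia.
have low : 5 * (2 * H + k) + e - s < 20 * H -> bisect (5 * (2 * H + k) + e - s) =
    let u := 5 * (2 * H + k) + e - s in let S := 5 * H in
    if u == 3 * S - 3 then (2 * S - 4, S.+1)
    else if u == 4 * S - 3 then ((2 * S).+1, 2 * S - 4)
    else if u <= 3 * S then (u - S, S) else (2 * S, u - 2 * S).
  by move=> hu; apply: bisect_level; rewrite eS eS2 hu andbT; lia.
have high : 20 * H <= 5 * (2 * H + k) + e - s -> bisect (5 * (2 * H + k) + e - s) =
    let u := 5 * (2 * H + k) + e - s in let S := 10 * H in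
    if u == 3 * S - 3 then (2 * S - 4, S.+1)
    else if u == 4 * S - 3 then ((2 * S).+1, 2 * S - 4)
    else if u <= 3 * S then (u - S, S) else (2 * S, u - 2 * S).
  by move=> hu; rewrite -eS; apply: bisect_level; rewrite eS2 eS3 hu; lia.
have [s0|s0] := posnP s; last first.
  have [k0 e0] := hsk s0; have [hkH|hkH] := leqP k H.
    apply: (step k 0 s 0 0 0); [|lia|lia|by move=> i hi; rewrite /weight ?ltn0; split; do ! case: ifP => ? /=; lia].
    rewrite low; last by lia.
    by cbv zeta; case: ifP => ?; last case: ifP => ?; last case: ifP => ?; congr pair; lia.
  apply: (step H 0 0 (k - H) 0 s); [|lia|lia|by move=> i hi; rewrite /weight ?ltn0; split; do ! case: ifP => ? /=; lia].
  rewrite low; last by lia.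
  by cbv zeta; case: ifP => ?; last case: ifP => ?; last case: ifP => ?; congr pair; lia.
clear hsk; subst s; have [h1|h1] := eqVneq k (2 * H).
  (* All positions carry two stars, so the size has reached the next level of [bisect]. *)
  apply: (step H e 0 H 0 0); [|lia|lia|by move=> i hi; rewrite /weight ?ltn0; split; do ! case: ifP => ? /=; lia].
  rewrite high; last by lia.
  by cbv zeta; case: ifP => ?; last case: ifP => ?; last case: ifP => ?; congr pair; lia.
have {}low := low ltac:(lia).
have [h2|h2] := leqP H k.
  have [h3|h3] := leqP (k + e) (2 * H).
    apply: (step H 0 0 (k - H) e 0); [|lia|lia|by move=> i hi; rewrite /weight ?ltn0; split; do ! case: ifP => ? /=; lia].
    rewrite low; cbv zeta.
    by case: ifP => ?; last case: ifP => ?; last case: ifP => ?; congr pair; lia.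
  (* Here [k = 2 * H - 1] and [e = 2]: the special size [4 * S - 3]. *)
  apply: (step H 1 0 (H - 1) 1 0); [|lia|lia|by move=> i hi; rewrite /weight ?ltn0; split; do ! case: ifP => ? /=; lia].
  rewrite low; cbv zeta.
  by case: ifP => ?; last case: ifP => ?; last case: ifP => ?; congr pair; lia.
have [h3|h3] := leqP (k + e) H.
  apply: (step k e 0 0 0 0); [|lia|lia|by move=> i hi; rewrite /weight ?ltn0; split; do ! case: ifP => ? /=; lia].
  rewrite low; cbv zeta.
  by case: ifP => ?; last case: ifP => ?; last case: ifP => ?; congr pair; lia.
(* Here [k = H - 1] and [e = 2]: the special size [3 * S - 3]. *)
apply: (step (H - 1) 1 0 0 1 0); [|lia|lia|by move=> i hi; rewrite /weight ?ltn0; split; do ! case: ifP => ? /=; lia].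
rewrite low; cbv zeta.
by case: ifP => ?; last case: ifP => ?; last case: ifP => ?; congr pair; lia.
Qed.

Lemma base_tree_full h k :
  base_tree h (2 ^ h.-1 + k) = full h.-1 (fun j => if j < k then big else star3) 0.
Proof. by apply: full_ext => j _; rewrite addKn. Qed.

Lemma modify_full0 d f j q g : j < 2 ^ d ->
  modify_at g (addr d j ++ q) (full d f 0) =
  full d (fun i => if i == j then modify_at g q (f i) else f i) 0.
Proof. by move=> hj; rewrite modify_full. Qed.

(** By truncated subtraction at most one of the last two arguments of [filled] is nonzero: the
    number of added or of removed leaves. *)
Lemma Tn_filled n h k : let m := 2 ^ h.-1 + k in 0 < k <= 2 ^ h.-1 ->
  5 * m <= n + 3 -> n <= 5 * m + 1 ->
  Tn n h m = filled h.-1 k (n.+1 - 5 * m) (5 * m - n.+1).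
Proof.
move=> m hk h1 h2; rewrite /Tn base_tree_full; set d := h.-1 in m hk h1 h2 *.
set t0 := full d _ 0; set H := 2 ^ d in m hk h1 h2 *.
have [d1 d2] := base_leafy_deep_first hk; have [d3 d4] := base_leafy_deep_last hk.
have d5 := base_last_leaf hk; have sh i := @base_leafy_shallow d k hk i.
rewrite -/t0 -/H in d1 d2 d3 d4 d5 sh.
have k1 : k.-1 < H by lia.
have H0 : 0 < H by lia.
case: eqP => e1.
  have -> : n.+1 - 5 * m = 0 by lia.
  have -> : 5 * m - n.+1 = 0 by lia.
  apply: full_ext => j hj; rewrite /weight !ltn0 !add0n !addn0 if_same subn0.
  by case: ltnP => hjk; rewrite ?addn0 // ltnNge hjk.
case: eqP => e2.
  have -> : n.+1 - 5 * m = 0 by lia.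
  have -> : 5 * m - n.+1 = 1 by lia.
  rewrite /del_vertex d5 last_cat size_cat size_addr /= addn2 /=.
  have -> : addr d k.-1 ++ [:: 1; 2] = (addr d k.-1 ++ [:: 1]) ++ [:: 2] by rewrite -catA.
  rewrite take_cat size_cat size_addr /= addn1 ltnn subnn cats0.
  rewrite modify_full0 //; apply: full_ext => j hj; rewrite /weight !ltn0 !add0n !addn0.
  have -> : (j.+1 == k) = (j == k.-1) by lia.
  by case: eqP => ej; case: ltnP => hjk //; lia.
case: eqP => e3.
  have -> : n.+1 - 5 * m = 0 by lia.
  have -> : 5 * m - n.+1 = 2 by lia.
  rewrite d3 d4 modify_full0 // modify_full0 //; apply: full_ext => j hj.
  rewrite /weight !ltn0 !add0n !addn0.
  have -> : (j.+1 == k) = (j == k.-1) by lia.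
  by case: eqP => ej; case: ltnP => hjk //; lia.
case: eqP => e4.
  have -> : n.+1 - 5 * m = 1 by lia.
  have -> : 5 * m - n.+1 = 0 by lia.
  have [kH|kH] := ltnP k H.
    rewrite sh; last by lia.
    rewrite addn0 -[addr d k]cats0 modify_full0 //; apply: full_ext => j hj.
    rewrite /weight if_same subn0 !add0n.
    have -> : (H - k + 2 * j < 1) = false by lia.
    have -> : ((H - k + 2 * j).+1 < 1) = false by lia.
    case: ltnP => hjk; first by rewrite ifF //; lia.
    case: eqP => ej; first by have -> : (j < k + 1) = true by lia.
    by have -> : (j < k + 1) = false by lia.
  have ek : k = H by lia.
  have -> : nth [::] (leafy t0) 0 = addr d 0 ++ [:: 0] by rewrite -d1 ek subnn.
  rewrite modify_full0 //; apply: full_ext => j hj; rewrite /weight if_same subn0 !add0n.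
  rewrite -[2 ^ d]/H -ek subnn add0n.
  have -> : (2 * j < 1) = (j == 0) by lia.
  have -> : ((2 * j).+1 < 1) = false by lia.
  have -> : (j < k) = true by lia.
  by case: eqP.
have -> : n.+1 - 5 * m = 2 by lia.
have -> : 5 * m - n.+1 = 0 by lia.
have [kH|kH] := ltnP k.+1 H.
  rewrite !sh; [|lia|lia].
  rewrite addn0 addn1 -[addr d k]cats0 -[addr d k.+1]cats0 modify_full0; last by lia.
  rewrite modify_full0 //; apply: full_ext => j hj.
  rewrite /weight if_same subn0 !add0n.
  have -> : (H - k + 2 * j < 2) = false by lia.
  have -> : ((H - k + 2 * j).+1 < 2) = false by lia.
  case: ltnP => hjk.
    have -> : (j == k.+1) = false by lia.
    by have -> : (j == k) = false by lia.
  case: eqP => ej.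
    have -> : (j == k) = false by lia.
    by have -> : (j < k + 2) = true by lia.
  case: eqP => ej'; first by have -> : (j < k + 2) = true by lia.
  by have -> : (j < k + 2) = false by lia.
have [kH'|kH'] := ltnP k H.
  have -> : nth [::] (leafy t0) 1 = addr d 0 ++ [:: 0] by rewrite -d1; congr nth; lia.
  rewrite sh; last by lia.
  rewrite addn0 -[addr d k]cats0 modify_full0 // modify_full0 //; apply: full_ext => j hj.
  rewrite /weight if_same subn0 !add0n.
  have -> : (H - k + 2 * j < 2) = (j == 0) by lia.
  have -> : ((H - k + 2 * j).+1 < 2) = false by lia.
  case: ltnP => hjk.
    have -> : (j == k) = false by lia.
    by case: eqP.
  have -> : (j == 0) = false by lia.
  have -> : (j < k + 2) = true by lia.
  by have -> : (j == k) = true by lia.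
have ek : k = H by lia.
have -> : nth [::] (leafy t0) 0 = addr d 0 ++ [:: 0] by rewrite -d1 ek subnn.
have -> : nth [::] (leafy t0) 1 = addr d 0 ++ [:: 1] by rewrite -d2 ek subnn.
rewrite modify_full0 // modify_full0 //; apply: full_ext => j hj.
rewrite /weight if_same subn0 !add0n -[2 ^ d]/H -ek subnn add0n.
have -> : (2 * j < 2) = (j == 0) by lia.
have -> : ((2 * j).+1 < 2) = (j == 0) by lia.
have -> : (j < k) = true by lia.
by case: eqP.
Qed.

Lemma Tn_canon n h m : 6 < n -> 5 * 2 ^ h.-1 + 1 < n <= 5 * 2 ^ h + 1 ->
  (forall k : nat, distn n.+1 (5 * m) <= distn n.+1 (5 * k)) ->
  Tn n h m = canon_tree n.+1.
Proof.
move=> hn hh near.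
have [h1 h2] : 5 * m <= n + 3 /\ n <= 5 * m + 1.
  (* Rounding [(n + 3) / 5] down gives an integer whose multiple by 5 is within 2 of [n + 1]. *)
  by have := near ((n + 3) %/ 5); rewrite /distn; lia.
have h0 : 0 < h by case: h hh {near} => //; rewrite /= expn0; lia.
have eh : 2 ^ h = 2 * 2 ^ h.-1 by rewrite -expnS prednK.
rewrite eh in hh.
have [k em] : exists k, m = 2 ^ h.-1 + k by exists (m - 2 ^ h.-1); lia.
subst m; rewrite Tn_filled //; last by lia.
rewrite filled_canon; [congr canon_tree; lia|lia..].
Qed.

Theorem theorem4p3 (n h m : nat) :
  6 < n ->
  5 * 2 ^ h.-1 + 1 < n <= 5 * 2 ^ h + 1 ->
  (* m is the nearest integer to (n+1)/5 *)
  (forall k : nat, distn n.+1 (5 * m) <= distn n.+1 (5 * k)) ->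
  let T := Tn n h m in
  [/\ tree_order T = n, minimal T,
      n %% 5 != 2 ->
        forall T' : tree, tree_order T' = n -> minimal T' -> iso T' T
    & n %% 5 = 2 ->
        exists2 p : seq nat,
          (p \in verts T) /\ iso (subtree_at T p) Q22 &
          (forall q : seq nat, q \in verts T -> iso (subtree_at T q) Q22 -> q = p) /\
          (forall T' : tree, tree_order T' = n ->
             (minimal T' <-> iso T' T \/ iso T' (modify_at (fun _ => R311) p T)))].
Proof.
move=> hn hh near; rewrite (Tn_canon hn hh near) => {hh near h m} T.
have sT : size_code T = n.+1 by apply: size_code_canon; lia.
have tT : tight T by rewrite /tight sT.
split=> [||hr T' oT' /minimal_tight tT'|hr].
- by move: sT => -[].
- exact/minimal_tight.
- by apply: tight_unique => //; [move/eqP: hr; lia|lia|rewrite /size_code oT'].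
have [p [hp es uq [sV cV] ht]] := @defect_branch n.+1 ltac:(lia) ltac:(lia).
exists p; first by split=> //; rewrite es; apply: iso_refl.
(* A branch isomorphic to [Q22] has size code 8, which determines its address. *)
split=> [q hq /iso_inv[e _]|T' oT']; first exact: uq.
have sT' : size_code T' = n.+1 by rewrite /size_code oT'.
split=> [/minimal_tight|[/iso_inv[_ e]|/iso_inv[_ e]]]; first exact: ht.
  by apply/minimal_tight; rewrite /tight sT' e.
by apply/minimal_tight; rewrite /tight sT' e cV.
Qed.
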